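(* There exists a polynomial-time algorithm that, given an instance $I=(C,V,\Pi,p)$ of Copeland$^\alpha$-shift-bribery with $\alpha\in[0,1]\cap\mathbb{Q}$ and $|C|=m$, outputs a shift-action $\mathbf{s}$ such that $p$ is a (Copeland$^\alpha$-)winner in $\mathrm{shf}(C,V,\mathbf{s})$ and $\Pi(\mathbf{s})\le m\cdot\mathrm{opt}(I)$.
   Context: $\mathbb{Z}^+$ denotes the set of all nonnegative integers. An election is a pair $E=(C,V)$ with $C$ a set of $m$ candidates and $V=(v^1,\dots,v^n)$ a list of voters, each voter $v^i$ being a strict linear order $\succ^i$ over $C$. Copeland$^\alpha$ (for rational $\alpha\in[0,1]$): let $N_E(a,b)$ be the number of voters in $E$ who prefer $a$ to $b$. Candidate $a$ wins the pairwise election against $b$ if $N_E(a,b)>N_E(b,a)$ and ties it if $N_E(a,b)=N_E(b,a)$. Each candidate gets one point for each pairwise election (against another candidate) that it wins and $\alpha$ points for each one that it ties. The winners are all candidates with the maximum score (ties allowed). $\mathcal{R}$-shift-bribery: an instance is $I=(C,V,\Pi,p)$ where $C=\{p,c_1,\dots,c_{m-1}\}$, $V=(v^1,\dots,v^n)$ is a list of linear orders over $C$, $p\in C$ is the designated candidate, and $\Pi=(\pi^1,\dots,\pi^n)$ is a list of cost functions $\pi^i:\mathbb{Z}^+\to\mathbb{Z}^+$ with $\pi^i(0)=0$, $\pi^i(k)\le\pi^i(k+1)$ for all $k$, and $\pi^i(s)=\pi^i(t-1)$ for all $s\ge t$, where $t$ is the position of $p$ in $\succ^i$. A shift-action is $\mathbf{t}=(t_1,\dots,t_n)\in(\mathbb{Z}^+)^n$;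 its cost is $\Pi(\mathbf{t})=\sum_{i=1}^n\pi^i(t_i)$. The election $\mathrm{shf}(C,V,\mathbf{t})$ is obtained from $(C,V)$ by moving $p$ upwards by $t_i$ positions in the $i$-th vote for each $i$ (or to the top if fewer than $t_i$ candidates are above $p$), leaving the relative order of the other candidates unchanged. $\mathbf{t}$ is successful if $p$ is an $\mathcal{R}$-winner of $\mathrm{shf}(C,V,\mathbf{t})$, and $\mathrm{opt}(I)$ is the minimum of $\Pi(\mathbf{t})$ over successful shift-actions. Running time is measured in the size of the input, with all numbers (the entries of $\Pi$, and the numerator and denominator of $\alpha$) written in binary. *)

(* Defs.v *)
From HB Require Import structures.
From mathcomp Require Import all_boot all_order all_algebra.

Set Implicit Arguments.
Unset Strict Implicit.
Unset Printing Implicit Defensive.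

Import Order.TTheory GRing.Theory Num.Theory.

(* A strict linear order is the list of all candidates from the most to the   *)
(* least preferred one; the position of a in v, counted from 1, is thus       *)
(* (index a v).+1.                                                            *)

Definition linear_order (m : nat) (v : seq 'I_m) : bool :=
  perm_eq v (enum 'I_m).

Definition prefers (m : nat) (v : seq 'I_m) (a b : 'I_m) : bool :=
  index a v < index b v.

Definition profile (m n : nat) : Type := n.-tuple (seq 'I_m).

Definition nprefer (m n : nat) (V : profile m n) (a b : 'I_m) : nat :=
  #|[set i : 'I_n | prefers (tnth V i) a b]|.

Definition voting_rule : Type := forall m n : nat, profile m n -> pred 'I_m.

Definition copeland_score (alpha : rat) (m n : nat) (V : profile m n)
    (a : 'I_m) : rat :=
  (\sum_(b | b != a)
     (if (nprefer V b a < nprefer V a b)%N then 1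
      else if nprefer V a b == nprefer V b a then alpha else 0))%R.

Definition copeland (alpha : rat) : voting_rule := fun m n V a =>
  [forall b, (copeland_score alpha V b <= copeland_score alpha V a)%R].

Definition cost_function (m : nat) (p : 'I_m) (v : seq 'I_m)
    (pi : nat -> nat) : Prop :=
  [/\ pi 0 = 0,
      forall k, pi k <= pi k.+1
    & forall s, (index p v).+1 <= s -> pi s = pi (index p v)].

Record instance : Type := Instance {
  ncand : nat;
  nvoters : nat;
  votes : profile ncand nvoters;
  prices : nvoters.-tuple (nat -> nat);
  preferred : 'I_ncand;
  votes_linear : forall i, linear_order (tnth votes i);
  prices_cost : forall i,
    cost_function preferred (tnth votes i) (tnth prices i)
}.

Definition shift_action (I : instance) : Type := (nvoters I).-tuple nat.

Definition shift_up (m : nat) (p : 'I_m) (k : nat) (v : seq 'I_m) : seq 'I_m :=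
  let others := rem p v in
  let j := index p v - k in
  take j others ++ p :: drop j others.

Definition shf (I : instance) (t : shift_action I) :
    profile (ncand I) (nvoters I) :=
  [tuple shift_up (preferred I) (tnth t i) (tnth (votes I) i)
     | i < nvoters I].

Definition cost (I : instance) (t : shift_action I) : nat :=
  \sum_(i < nvoters I) tnth (prices I) i (tnth t i).

Definition successful (R : voting_rule) (I : instance) (t : shift_action I) :
    bool :=
  R _ _ (shf t) (preferred I).

Definition is_opt (R : voting_rule) (I : instance) (o : nat) : Prop :=
  (exists2 t : shift_action I, successful R t & cost t = o) /\
  (forall t : shift_action I, successful R t -> o <= cost t).

(* Algorithms are finite systems of mutually recursive first-order functions  *)
(* of one argument over binary trees, evaluated by value: the language F of   *)
(* N. D. Jones, Computability and Complexity, with local variables as de      *)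
(* Bruijn indices (let and case).                                             *)

Inductive data : Type := Leaf | Node of data & data.

Fixpoint dsize (d : data) : nat :=
  if d is Node a b then (dsize a + dsize b).+1 else 1.

Inductive expr : Type :=
| EVar of nat
| ELeaf
| ENode of expr & expr
| ELet of expr & expr
| ECase of expr & expr & expr
| ECall of nat & expr.

(* The f-th entry is the body of function f; its argument is variable 0, and  *)
(* function 0 is the entry point.                                             *)
Definition program : Type := seq expr.

(* eval P env e d t : in the environment env, e evaluates to d in time t.     *)
(* Every tree that is read from a variable or constructed is charged by its   *)
(* number of nodes, as if it were copied; hence dsize d <= t, trees cannot    *)
(* grow exponentially through sharing, and time is polynomially related to    *)
(* that of Turing machines.  In ECase e e0 e1 the left and right subtrees are *)
(* variables 0 and 1 of e1.                                                   *)
Inductive eval (P : program) : seq data -> expr -> data -> nat -> Prop :=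
| eval_var env i :
    eval P env (EVar i) (nth Leaf env i) (dsize (nth Leaf env i))
| eval_leaf env : eval P env ELeaf Leaf 1
| eval_node env e1 e2 a b t1 t2 :
    eval P env e1 a t1 -> eval P env e2 b t2 ->
    eval P env (ENode e1 e2) (Node a b) (t1 + t2 + dsize (Node a b))
| eval_let env e1 e2 a b t1 t2 :
    eval P env e1 a t1 -> eval P (a :: env) e2 b t2 ->
    eval P env (ELet e1 e2) b (t1 + t2).+1
| eval_case_leaf env e e0 e1 b t1 t2 :
    eval P env e Leaf t1 -> eval P env e0 b t2 ->
    eval P env (ECase e e0 e1) b (t1 + t2).+1
| eval_case_node env e e0 e1 l r b t1 t2 :
    eval P env e (Node l r) t1 -> eval P [:: l, r & env] e1 b t2 ->
    eval P env (ECase e e0 e1) b (t1 + t2).+1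
| eval_call env f e a b t1 t2 :
    eval P env e a t1 -> eval P [:: a] (nth ELeaf P f) b t2 ->
    eval P env (ECall f e) b (t1 + t2).+1.

Definition runs (P : program) (input output : data) (t : nat) : Prop :=
  eval P [:: input] (nth ELeaf P 0) output t.

Definition enc_bool (b : bool) : data := if b then Node Leaf Leaf else Leaf.

Definition enc_seq (T : Type) (enc : T -> data) (s : seq T) : data :=
  foldr (fun x d => Node (enc x) d) Leaf s.

(* Least significant bit first, without leading zeros: up_log 2 n.+1 is the   *)
(* number of binary digits of n.                                              *)
Definition bits (n : nat) : seq bool :=
  [seq odd (n %/ 2 ^ i) | i <- iota 0 (up_log 2 n.+1)].

Definition enc_nat (n : nat) : data := enc_seq enc_bool (bits n).

Definition enc_cand (m : nat) (a : 'I_m) : data := enc_nat a.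

(* A cost function is given by its values at 0, ..., t - 1, where t is the    *)
(* position of p; they determine the other values.                            *)
Definition enc_price (m : nat) (p : 'I_m) (v : seq 'I_m) (pi : nat -> nat) :
    data :=
  enc_seq enc_nat (mkseq pi (index p v).+1).

(* Only used for alpha >= 0, so the sign of the numerator is not encoded.     *)
Definition enc_input (alpha : rat) (I : instance) : data :=
  Node (Node (enc_nat `|numq alpha|) (enc_nat `|denq alpha|))
    (Node (enc_seq (@enc_cand (ncand I)) (enum 'I_(ncand I)))
      (Node (enc_seq (enc_seq (@enc_cand (ncand I))) (votes I))
        (Node (enc_seq (fun i => enc_price (preferred I) (tnth (votes I) i)
                                   (tnth (prices I) i))
                 (enum 'I_(nvoters I)))
          (enc_cand (preferred I))))).

Definition enc_action (I : instance) (t : shift_action I) : data :=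
  enc_seq enc_nat t.

(* Main.v *)
(* Call y c j the price of lifting p just above c in vote j.  For a budget D and *)
(* each candidate c separately, buy the votes in increasing order of y c j while *)
(* their total is at most D, and take in every vote the largest of the shifts    *)
(* bought for the various c.  The result costs at most m D, since price lists    *)
(* are monotone.  If D >= opt, then in this action p is above each c in at least *)
(* as many votes as in an optimal one, so every pairwise contest of p ends at    *)
(* least as well, the others are unaffected, and p wins.  The outcome depends    *)
(* only on which of the partial sums of the prices are at most D, so it suffices *)
(* to try these polynomially many values of D and keep the least one for which p *)
(* wins, which is at most opt.                                                   *)
(*                                                                               *)
(* For the running time, the functions computable in polynomial time contain     *)
(* binary arithmetic and are closed under composition, branching and folds over  *)
(* lists whose accumulator grows only additively.                                *)

Require Import Defs.
From HB Require Import structures.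
From mathcomp Require Import all_boot all_order all_algebra.
From mathcomp Require Import zify.

Import Order.TTheory GRing.Theory Num.Theory.

Set Implicit Arguments.
Unset Strict Implicit.
Unset Printing Implicit Defensive.

(** * Functions computable in polynomial time *)

(** Correctness rests on a greedy fact. For a fixed rival c, the voters affordable within D form an
    initial segment of the price order, their total price is at most D ([sum_affordable]), and no
    set of voters of total price at most D is larger ([card_affordable]). After a shift, p's support
    against c is the number of votes lifted by at least [shift_need c] ([nprefer_shf]), and Copeland
    success survives when p gains support against every rival while the other contests stay fixed
    ([copeland_mono]). Hence a successful action yields a winning budget not above its cost
    ([wins_budget]), whereas the action for a budget D pays at most D per candidate ([cost_action]).
    Taking an optimal action, which exists by [opt_exists], gives the ratio m.

    The running time is handled without writing a program by hand. [PT f] says that some relocatable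
    program computes f in polynomial time, and the class is closed under the constructions used in
    [solve]. The only loop is [PT_foldl]; its accumulator may grow per iteration only by an amount
    bounded by the parameter and the current element. Numbers are lists of bits, so addition and
    comparison are such folds, and multiplication is avoided by writing scores as sums. [solve]
    works on nested lists of naturals whose encoding agrees with that of the instance
    ([enc_instance_input]), and [winsE] identifies its test with true Copeland success. *)

Definition pbound (T : Type) (sz g : T -> nat) : Prop :=
  exists k, forall x, g x <= (sz x).+2 ^ k.

Section Poly.
Variables (T : Type) (sz : T -> nat).
Implicit Types g h : T -> nat.

Lemma leq_pbound g h : pbound sz h -> (forall x, g x <= h x) -> pbound sz g.
Proof. by case=> k hk le; exists k => x; apply: leq_trans (le x) (hk x). Qed.

Lemma pbound_size : pbound sz sz.
Proof. by exists 1 => x; rewrite expn1 -addn2 leq_addr. Qed.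

Lemma pbound_const c : pbound sz (fun=> c).
Proof.
exists c => x; apply: leq_trans (ltnW (ltn_expl c (ltnSn 1))) _.
by case: c => // c; rewrite leq_exp2r.
Qed.

(** The base is at least 2, so a sum of two powers is absorbed by one more factor; for the same
    reason [pbound] can do without coefficients. *)
Lemma pboundD g h : pbound sz g -> pbound sz h -> pbound sz (fun x => g x + h x).
Proof.
move=> [k hk] [l hl]; exists (maxn k l).+1 => x.
have le i : i <= maxn k l -> (sz x).+2 ^ i <= (sz x).+2 ^ maxn k l.
  by move=> ?; rewrite leq_exp2l.
rewrite expnS; apply: (@leq_trans (2 * (sz x).+2 ^ maxn k l)); last first.
  by rewrite leq_mul2r orbT.
rewrite mul2n -addnn leq_add //.
  by apply: leq_trans (hk x) (le _ _); rewrite leq_maxl.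
by apply: leq_trans (hl x) (le _ _); rewrite leq_maxr.
Qed.

Lemma pboundM g h : pbound sz g -> pbound sz h -> pbound sz (fun x => g x * h x).
Proof.
by move=> [k hk] [l hl]; exists (k + l) => x; rewrite expnD leq_mul.
Qed.

Lemma pboundX g k : pbound sz g -> pbound sz (fun x => g x ^ k).
Proof.
move=> pg; elim: k => [|k IH]; first exact: pbound_const.
by apply: leq_pbound (pboundM pg IH) _ => x; rewrite expnS.
Qed.

Lemma pbound_comp (U : Type) (szU h : U -> nat) (f : T -> U) :
  pbound szU h -> pbound sz (fun x => szU (f x)) -> pbound sz (fun x => h (f x)).
Proof.
move=> [k hk] pf; apply: leq_pbound (pboundX k (pboundD pf (pbound_const 2))) _ => x.
by rewrite addn2 hk.
Qed.

End Poly.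

(** * Encodings and basic closure properties *)

Record code : Type := Code { csort :> Type; enc : csort -> data }.
Arguments enc {c} x : rename.

Canonical code_bool := Code enc_bool.
Canonical code_nat := Code enc_nat.
Canonical code_seq (A : code) := Code (enc_seq (@enc A)).
Canonical code_prod (A B : code) :=
  Code (fun z : A * B => Node (enc z.1) (enc z.2)).

Definition csize (A : code) (x : A) : nat := dsize (enc x).

Lemma eval_size P env e d t : eval P env e d t -> dsize d <= t.
Proof. by elim=> * /=; lia. Qed.

(* The environment below variable 0 is arbitrary, so e can be placed under any *)
(* binder; programs are linked by choosing the position n of the code Q.       *)
Definition computes (A B : code) (f : A -> B) (T : A -> nat) n Q e : Prop :=
  forall P R, size P = n -> forall (x : A) env,
  exists2 t, t <= T x & eval (P ++ Q ++ R) (enc x :: env) e (enc (f x)) t.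

(* PT f: the function f is computable in polynomial time. *)
Definition PT (A B : code) (f : A -> B) : Prop :=
  exists2 T, pbound (@csize A) T &
    forall n, exists Q e, computes f T n Q e.

Definition PT2 (A B C : code) (f : A -> B -> C) : Prop :=
  PT (fun z : code_prod A B => f z.1 z.2).

Definition PT3 (A B C D : code) (f : A -> B -> C -> D) : Prop :=
  PT (fun z : code_prod A (code_prod B C) => f z.1 z.2.1 z.2.2).

Section Combinators.
Variables A B C : code.

Lemma PT_size (f : A -> B) : PT f -> pbound (@csize A) (fun x => csize (f x)).
Proof.
case=> T pT /(_ 0) [Q [e he]]; apply: leq_pbound pT _ => x.
have [t le_t ev] := he [::] [::] erefl x [::].
exact: leq_trans (eval_size ev) le_t.
Qed.

Lemma PT_ext (f g : A -> B) : (forall x, f x = g x) -> PT f -> PT g.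
Proof.
move=> eqfg [T pT hf]; exists T => // n.
have [Q [e he]] := hf n; exists Q, e => P R sP x env.
by rewrite -eqfg; apply: he.
Qed.

(** A program sees only encodings, so types with the same trees are interchangeable: a list cell is
    a pair, and a number is its list of bits. *)
Lemma PT_enc_eq (f : A -> B) (g : A -> C) :
  (forall x, enc (f x) = enc (g x)) -> PT f -> PT g.
Proof.
move=> eqfg [T pT hf]; exists T => // n.
have [Q [e he]] := hf n; exists Q, e => P R sP x env.
by rewrite -eqfg; apply: he.
Qed.

Lemma PT_id : PT (fun x : A => x).
Proof.
exists (@csize A); first exact: pbound_size.
move=> n; exists [::], (EVar 0) => P R _ x env; exists (csize x) => //.
by constructor.
Qed.

Fixpoint const_expr (d : data) : expr :=
  if d is Node a b then ENode (const_expr a) (const_expr b) else ELeaf.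

Fixpoint const_time (d : data) : nat :=
  if d is Node a b then const_time a + const_time b + dsize d else 1.

Lemma eval_const P env d : eval P env (const_expr d) d (const_time d).
Proof. by elim: d => [|a h1 b h2]; constructor. Qed.

Lemma PT_const (b : B) : PT (fun _ : A => b).
Proof.
exists (fun=> const_time (enc b)); first exact: pbound_const.
move=> n; exists [::], (const_expr (enc b)) => P R _ x env.
by exists (const_time (enc b)) => //; apply: eval_const.
Qed.

Lemma PT_comp (g : B -> C) (f : A -> B) :
  PT g -> PT f -> PT (fun x => g (f x)).
Proof.
move=> [Tg pg hg] PTf; have pfx := PT_size PTf; have [Tf pf hf] := PTf.
exists (fun x => (Tf x + Tg (f x)) + 1).
  by apply: pboundD (pbound_const _ _); apply: pboundD => //; apply: pbound_comp pfx.
move=> n; have [Qf [ef cf]] := hf n; have [Qg [eg cg]] := hg (n + size Qf).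
exists (Qf ++ Qg), (ELet ef eg) => P R sP x env.
have [t1 le1 ev1] := cf P (Qg ++ R) sP x env.
have sP' : size (P ++ Qf) = n + size Qf by rewrite size_cat sP.
have [t2 le2 ev2] := cg (P ++ Qf) R sP' (f x) (enc x :: env).
exists (t1 + t2).+1; first by rewrite -addn1 leq_add2r leq_add.
rewrite -!catA in ev2 *.
by apply: eval_let ev2; rewrite ?catA // -?catA.
Qed.

Lemma PT_pair (f : A -> B) (g : A -> C) :
  PT f -> PT g -> PT (B := code_prod B C) (fun x => (f x, g x)).
Proof.
move=> [Tf pf hf] [Tg pg hg].
exists (fun x => (Tf x + Tg x) + (Tf x + Tg x + 1)).
  by apply: pboundD; do ?apply: pboundD => //; apply: pbound_const.
move=> n; have [Qf [ef cf]] := hf n; have [Qg [eg cg]] := hg (n + size Qf).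
exists (Qf ++ Qg), (ENode ef eg) => P R sP x env.
have [t1 le1 ev1] := cf P (Qg ++ R) sP x env.
have sP' : size (P ++ Qf) = n + size Qf by rewrite size_cat sP.
have [t2 le2 ev2] := cg (P ++ Qf) R sP' x env.
have := eval_size ev1; have := eval_size ev2 => s2 s1.
exists (t1 + t2 + dsize (Node (enc (f x)) (enc (g x)))); first by simpl; lia.
rewrite -!catA in ev2 *.
by apply: eval_node.
Qed.

Lemma PT_fst (f : A -> B * C) :
  PT (B := code_prod B C) f -> PT (fun x => (f x).1).
Proof.
move=> [Tf pf hf]; exists (fun x => Tf x + Tf x + 1).
  by apply: pboundD; do ?apply: pboundD => //; apply: pbound_const.
move=> n; have [Q [e c]] := hf n; exists Q, (ECase e ELeaf (EVar 0)) => P R sP x env.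
have [t le_t ev] := c P R sP x env; have := eval_size ev => /= s.
exists (t + dsize (enc (f x).1)).+1; first by lia.
apply: eval_case_node ev _.
exact: (@eval_var _ [:: enc (f x).1, enc (f x).2 & enc x :: env] 0).
Qed.

Lemma PT_snd (f : A -> B * C) :
  PT (B := code_prod B C) f -> PT (fun x => (f x).2).
Proof.
move=> [Tf pf hf]; exists (fun x => Tf x + Tf x + 1).
  by apply: pboundD; do ?apply: pboundD => //; apply: pbound_const.
move=> n; have [Q [e c]] := hf n; exists Q, (ECase e ELeaf (EVar 1)) => P R sP x env.
have [t le_t ev] := c P R sP x env; have := eval_size ev => /= s.
exists (t + dsize (enc (f x).2)).+1; first by lia.
apply: eval_case_node ev _.
exact: (@eval_var _ [:: enc (f x).1, enc (f x).2 & enc x :: env] 1).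
Qed.

End Combinators.

Section Branching.
Variables A B C D : code.

Lemma PT_cons (f : A -> B) (g : A -> seq B) :
  PT f -> PT (B := code_seq B) g -> PT (B := code_seq B) (fun x => f x :: g x).
Proof. by move=> hf hg; apply: PT_enc_eq (PT_pair hf hg). Qed.

Lemma PT_if (b : A -> bool) (f g : A -> B) :
  PT b -> PT f -> PT g -> PT (fun x => if b x then f x else g x).
Proof.
move=> [Tb pb hb] [Tf pf hf] [Tg pg hg].
exists (fun x => Tb x + (Tf x + Tg x) + 10 + csize x).
  apply: pboundD (pbound_size _); apply: pboundD (pbound_const _ _).
  by do ?apply: pboundD => //.
move=> n; have [Qb [eb cb]] := hb n; have [Qf [ef cf]] := hf (n + size Qb).
have [Qg [eg cg]] := hg (n + size Qb + size Qf).
exists (Qb ++ Qf ++ Qg).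
(* When the test is true, [ECase] pushes two subtrees; the input then has index 2 and is rebound as
   variable 0, where [ef] expects it. *)
exists (ECase eb eg (ELet (EVar 2) ef)) => P R sP x env.
have [t1 le1 ev1] := cb P (Qf ++ Qg ++ R) sP x env.
have sP' : size (P ++ Qb) = n + size Qb by rewrite size_cat sP.
have sP'' : size (P ++ Qb ++ Qf) = n + size Qb + size Qf.
  by rewrite !size_cat sP addnA.
rewrite -!catA.
case E: (b x) in ev1 *.
  have [t2 le2 ev2] := cf (P ++ Qb) (Qg ++ R) sP' x [:: Leaf, Leaf, enc x & env].
  exists (t1 + (csize x + t2).+1).+1; first by lia.
  rewrite -!catA in ev2.
  apply: eval_case_node ev1 _; apply: eval_let ev2.
  exact: (@eval_var _ [:: Leaf, Leaf, enc x & env] 2).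
have [t2 le2 ev2] := cg (P ++ Qb ++ Qf) R sP'' x env.
exists (t1 + t2).+1; first by lia.
rewrite -!catA in ev2.
exact: eval_case_leaf ev1 ev2.
Qed.

Lemma PT_seq_case (s : A -> seq B) (f : A -> C) (g : A -> B -> seq B -> C) :
  PT (B := code_seq B) s -> PT f -> PT3 (C := code_seq B) g ->
  PT (fun x => if s x is y :: r then g x y r else f x).
Proof.
move=> PTs [Tf pf hf] [Tg pg hg]; have pss := PT_size PTs.
have [Ts ps hs] := PTs.
have pg' : pbound (@csize A) (fun x => ((csize x + csize (s x)).+2)) by
  apply: leq_pbound (pboundD (pboundD (pbound_size _) pss) (pbound_const _ 2)) _
    => x; lia.
case: pg => k hk.
exists (fun x => Ts x + Tf x + ((csize x + csize (s x)).+2).+2 ^ k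
                 + 10 * (csize x + csize (s x)).+2 + 10).
  apply: pboundD (pbound_const _ _); apply: pboundD;
    last by apply: pboundM (pbound_const _ _) _.
  apply: pboundD; first by apply: pboundD.
  apply: pboundX; apply: leq_pbound (pboundD pg' (pbound_const _ 2)) _ => x; lia.
move=> n; have [Qs [es cs]] := hs n; have [Qf [ef cf]] := hf (n + size Qs).
have [Qg [eg cg]] := hg (n + size Qs + size Qf).
exists (Qs ++ Qf ++ Qg).
exists (ECase es ef (ELet (ENode (EVar 2) (ENode (EVar 0) (EVar 1))) eg)) => P R sP x env.
have [t1 le1 ev1] := cs P (Qf ++ Qg ++ R) sP x env.
have sP' : size (P ++ Qs) = n + size Qs by rewrite size_cat sP.
have sP'' : size (P ++ Qs ++ Qf) = n + size Qs + size Qf.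
  by rewrite !size_cat sP addnA.
rewrite -!catA; rewrite /csize.
move: ev1; case: (s x) => [|y r] ev1.
  have [t2 le2 ev2] := cf (P ++ Qs) (Qg ++ R) sP' x env.
  exists (t1 + t2).+1; first by lia.
  rewrite -!catA in ev2; exact: eval_case_leaf ev1 ev2.
have [t2 le2 ev2] := cg (P ++ Qs ++ Qf) R sP'' (x, (y, r))
   [:: enc y, enc r, enc x & env].
rewrite -!catA in ev2.
eexists; last first.
  apply: eval_case_node ev1 _; apply: eval_let ev2.
  apply: eval_node (@eval_var _ [:: enc y, enc r, enc x & env] 2) _.
  exact: eval_node (@eval_var _ [:: enc y, enc r, enc x & env] 0)
    (@eval_var _ [:: enc y, enc r, enc x & env] 1).
move: le2 (hk (x, (y, r))); rewrite /csize /=.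
rewrite -/(enc_seq _ _).
set u := dsize (enc x); set v := dsize (enc y); set w := dsize (enc_seq _ _) => le2.
have le3 : (u + (v + w).+1).+3 ^ k <= (u + (v + w).+1).+4 ^ k.
  by case: (k) => // k'; rewrite leq_exp2r.
move=> le4; lia.
Qed.

Lemma PT2_app (h : B -> C -> D) (f : A -> B) (g : A -> C) :
  PT2 h -> PT f -> PT g -> PT (fun x => h (f x) (g x)).
Proof.
by move=> hh hf hg; apply: (PT_comp hh (f := fun x => (f x, g x))); apply: PT_pair.
Qed.

End Branching.

Lemma PT3_app (A B C D E : code) (h : B -> C -> D -> E) (f : A -> B)
    (g : A -> C) (l : A -> D) :
  PT3 h -> PT f -> PT g -> PT l -> PT (fun x => h (f x) (g x) (l x)).
Proof.
move=> hh hf hg hl; apply: (PT_comp hh (f := fun x => (f x, (g x, l x)))).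
by do !apply: PT_pair.
Qed.

Lemma size_csize (A : code) (s : seq A) : size s < csize s.
Proof. by rewrite /csize /=; elim: s => //= x s IH; lia. Qed.

(** * Bounded recursion over lists *)

Section Fold.
Variables A B C : code.
Variables (s : A -> seq B) (a0 : A -> C) (step : A -> C -> B -> C).
Variable G : A * B -> nat.

(* In the innermost branch, variables 0, 1, 3 and 4 are the head and the tail   *)
(* of the list, the accumulator and the parameter x.                            *)
Definition fold_body (self : nat) (estep : expr) : expr :=
  ECase (EVar 0) ELeaf
    (ECase (EVar 1) ELeaf
      (ECase (EVar 0) (EVar 1)
        (ECall self (ENode (EVar 4) (ENode (EVar 1)
          (ELet (ENode (EVar 4) (ENode (EVar 3) (EVar 0))) estep)))))).

(** The invariant [csize a + size r * b <= K] reserves growth b for each remaining element. Every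
    accumulator thus has size at most K, all iterations share one time bound, and the total is that
    bound times the number of calls. *)
Lemma eval_fold (P : program) self estep (x : A) (b k S K : nat) :
    nth ELeaf P self = fold_body self estep ->
    (forall (a : C) (y : B) env, exists2 t,
       t <= (csize x + csize a + csize y).+4 ^ k &
       eval P (Node (enc x) (Node (enc a) (enc y)) :: env) estep
         (enc (step x a y)) t) ->
    (forall a y, csize y <= S -> csize (step x a y) <= csize a + b) ->
  forall (r : seq B) (a : C), csize r <= S -> csize a + size r * b <= K ->
  exists2 t, t <= (size r).+1 * ((csize x + K + S).+4 ^ k
                                 + 20 * (csize x + K + S).+4) &
    eval P [:: Node (enc x) (Node (enc r) (enc a))] (nth ELeaf P self)
      (enc (foldl (step x) a r)) t.
Proof.
move=> Pself ev_step growth; elim=> [|y r IH] a.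
  rewrite Pself => leS leK; eexists; last first.
    apply: eval_case_node.
      exact: (@eval_var _ [:: Node (enc x) (Node (enc [::]) (enc a))] 0).
    apply: eval_case_node.
      exact: (@eval_var _ [:: enc x, _ & _] 1).
    apply: eval_case_leaf.
      exact: (@eval_var _ [:: Leaf, _ & _] 0).
    exact: (@eval_var _ [:: Leaf, enc a & _] 1).
  move: leS leK; rewrite /csize /= mul0n; lia.
move=> leS leK.
have /= Esz : csize (y :: r) = (csize y + csize r).+1 by [].
have gr : csize (step x a y) <= csize a + b by apply: growth; lia.
have [||t le_t ev] := IH (step x a y); first by lia.
  by move: leK; rewrite /= mulSn; lia.
have [t1 le1 ev1] := ev_step a y
  [:: enc y, enc r, enc (y :: r), enc a, enc x,
      Node (enc (y :: r)) (enc a)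
    & [:: Node (enc x) (Node (enc (y :: r)) (enc a))]].
rewrite Pself /= mulSn; eexists; last first.
  apply: eval_case_node.
    exact: (@eval_var _ [:: Node (enc x) (Node (enc (y :: r)) (enc a))] 0).
  apply: eval_case_node.
    exact: (@eval_var _ [:: enc x, _ & _] 1).
  apply: eval_case_node.
    exact: (@eval_var _ [:: enc (y :: r), _ & _] 0).
  apply: eval_call ev.
  apply: eval_node; first exact: (@eval_var _ [:: _, _, _, _, enc x & _] 4).
  apply: eval_node; first exact: (@eval_var _ [:: _, enc r & _] 1).
  apply: eval_let ev1.
  apply: eval_node; first exact: (@eval_var _ [:: _, _, _, _, enc x & _] 4).
  apply: eval_node; first exact: (@eval_var _ [:: _, _, _, enc a & _] 3).
  exact: (@eval_var _ [:: enc y & _] 0).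
have le2 : (csize x + csize a + csize y).+4 ^ k <= (csize x + K + S).+4 ^ k.
  by case: (k) => // k'; rewrite leq_exp2r //; lia.
move: leK; rewrite /= mulSn => leK.
set u := (csize x + K + S).+4 ^ k in le2 le_t *.
move: leS gr leK; rewrite Esz.
have := leq_trans le1 le2; move: le_t; rewrite /csize /= -/(enc_seq _ _).
move: (dsize (enc x)) (dsize (enc y)) (dsize (enc_seq _ r)) (dsize (enc a)).
move=> u1 u2 u3 u4.
move: (dsize _) => u5.
set w := (_ * (u + _)); move: (size r * b) => ?; clear; lia.
Qed.

(* The accumulator grows by an additive term, not by a factor, per iteration:   *)
(* its size therefore remains polynomial throughout the loop.                   *)
Lemma PT_foldl :
    PT (B := code_seq B) s -> PT a0 -> PT3 step ->
    pbound (@csize (code_prod A B)) G ->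
    (forall x a y, csize (step x a y) <= csize a + G (x, y)) ->
  PT (fun x => foldl (step x) (a0 x) (s x)).
Proof.
move=> PTs PTa PTstep [l hl] growth.
have ps := PT_size PTs; have pa := PT_size PTa.
have [Ts pTs hs] := PTs; have [Ta pTa ha] := PTa; have [T [k hk] hT] := PTstep.
(* S bounds the list and its elements, b the growth per iteration, K every accumulator, and M the
   time of the whole loop. *)
pose S x := csize (s x).
pose b x := (csize x + S x).+4 ^ l.
pose K x := csize (a0 x) + S x * b x.
pose M x := (S x).+1 * ((csize x + K x + S x).+4 ^ k + 20 * (csize x + K x + S x).+4).
have pS4 (g : A -> nat) : pbound (@csize A) g -> pbound (@csize A) (fun x => (g x).+4).
  by move=> pg; apply: leq_pbound (pboundD pg (pbound_const _ 4)) _ => x; lia.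
have pb : pbound (@csize A) b by apply/pboundX/pS4/pboundD/ps; apply: pbound_size.
have pK : pbound (@csize A) K by apply: pboundD => //; apply: pboundM.
have pN : pbound (@csize A) (fun x => (csize x + K x + S x).+4).
  by apply/pS4/pboundD => //; apply/pboundD => //; apply: pbound_size.
have pM : pbound (@csize A) M.
  apply: pboundM.
    by apply: leq_pbound (pboundD ps (pbound_const _ 1)) _ => x; rewrite addn1.
  apply: pboundD; first exact: pboundX.
  by apply: pboundM => //; apply: pbound_const.
exists (fun x => (Ts x + Ta x) + M x + (csize x * 3 + (Ts x + Ta x) * 4 + 10)).
  do ?[exact: pbound_size | exact: pbound_const | exact: pTs | exact: pTa
     | exact: pM | apply: pboundD | apply: pboundM].
move=> n; have [Qs [es cs]] := hs n; have [Qa [ea ca]] := ha (n + size Qs).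
have [Qt [et ct]] := hT (n + size Qs + size Qa).
pose self := n + size Qs + size Qa + size Qt.
exists (Qs ++ Qa ++ Qt ++ [:: fold_body self et]).
exists (ECall self (ENode (EVar 0) (ENode es ea))) => P R sP x env.
have Ecat : P ++ (Qs ++ Qa ++ Qt ++ [:: fold_body self et]) ++ R =
            P ++ Qs ++ Qa ++ Qt ++ fold_body self et :: R.
  by rewrite -!catA.
rewrite Ecat; set P' := P ++ _.
have [t1 le1 ev1] := cs P (Qa ++ Qt ++ fold_body self et :: R) sP x env.
have sP1 : size (P ++ Qs) = n + size Qs by rewrite size_cat sP.
have [t2 le2 ev2] := ca (P ++ Qs) (Qt ++ fold_body self et :: R) sP1 x env.
have sP2 : size (P ++ Qs ++ Qa) = n + size Qs + size Qa.
  by rewrite !size_cat sP addnA.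
have Pself : nth ELeaf P' self = fold_body self et.
  rewrite /P' /self !catA nth_cat !size_cat sP ltnn subnn //.
have [|||t3 le3 ev3] := @eval_fold P' self et x (b x) k (S x) (K x) Pself
  _ _ (s x) (a0 x) (leqnn _) _.
- move=> a y env'.
  have [t le_t] := ct (P ++ Qs ++ Qa) (fold_body self et :: R) sP2 (x, (a, y)) env'.
  rewrite -!catA => ev; exists t => //; apply: leq_trans le_t _.
  apply: leq_trans (hk _) _; rewrite /csize /=.
  by case: (k) => // k'; rewrite leq_exp2r //; lia.
- move=> a y leS; apply: leq_trans (growth x a y) _; rewrite leq_add2l.
  apply: leq_trans (hl _) _; rewrite /b /csize /=.
  by case: (l) => // l'; rewrite leq_exp2r //; rewrite /csize in leS; lia.
- by rewrite /K leq_add2l leq_mul2r; apply/orP; right; exact/ltnW/size_csize.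
have le4 : t3 <= M x.
  apply: leq_trans le3 _; rewrite /M leq_mul2r; apply/orP; right.
  exact/leqW/size_csize.
have s1 := eval_size ev1; have s2 := eval_size ev2.
eexists; last first.
  apply: eval_call.
    apply: eval_node; first exact: (@eval_var _ (enc x :: env) 0).
    by apply: eval_node; [exact: ev1|rewrite -!catA in ev2; exact: ev2].
  exact: ev3.
rewrite /csize /=; rewrite /= in s1; lia.
Qed.
End Fold.

Section Lists.
Variables A B C : code.

Lemma PT_rev (s : A -> seq B) :
  PT (B := code_seq B) s -> PT (B := code_seq B) (fun x => rev (s x)).
Proof.
move=> PTs.
have h : PT (B := code_seq B) (fun x => foldl (fun t y => y :: t) [::] (s x)).
  apply: (@PT_foldl _ _ (code_seq B) s (fun=> [::]) (fun _ t y => y :: t)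
            (fun z => csize z)) => //.
  - exact: PT_const.
  - apply: (@PT_cons _ _ (fun z : code_prod A (code_prod (code_seq B) B) => z.2.2)
            (fun z => z.2.1)).
      by do !apply: PT_snd; apply: PT_id.
    by apply: PT_fst; apply: PT_snd; apply: PT_id.
  - exact: pbound_size.
  by move=> x a y; rewrite /csize /=; lia.
apply: PT_ext h => x; rewrite -[RHS]cats0; move: (s x) [::] => {s PTs x}.
by elim=> [|y r IH] t //=; rewrite IH rev_cons cat_rcons.
Qed.

Lemma PT_foldr (s : A -> seq B) (a0 : A -> C) (step : A -> B -> C -> C)
    (G : A * B -> nat) :
    PT (B := code_seq B) s -> PT a0 -> PT3 step ->
    pbound (@csize (code_prod A B)) G ->
    (forall x a y, csize (step x y a) <= csize a + G (x, y)) ->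
  PT (fun x => foldr (step x) (a0 x) (s x)).
Proof.
move=> PTs PTa PTstep pG growth.
have h : PT (fun x => foldl (fun a y => step x y a) (a0 x) (rev (s x))).
  apply: (@PT_foldl _ _ _ (fun x => rev (s x)) a0 (fun x a y => step x y a)
            G) => //; first exact: PT_rev.
  apply: (PT3_app (h := step) (f := fun z : code_prod A (code_prod C B) => z.1)
    (g := fun z => z.2.2) (l := fun z => z.2.1)) => //.
  - by apply: PT_fst; apply: PT_id.
  - by do !apply: PT_snd; apply: PT_id.
  by apply: PT_fst; apply: PT_snd; apply: PT_id.
by apply: PT_ext h => x; rewrite foldl_rev.
Qed.

End Lists.

Ltac pt_atom := solve [ repeat first [ exact: PT_id | apply: PT_fst | apply: PT_snd ] ].

Section MapFilter.
Variables A B C : code.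

Lemma PT_map (s : A -> seq B) (f : A -> B -> C) :
    PT (B := code_seq B) s -> PT2 f ->
  PT (B := code_seq C) (fun x => [seq f x y | y <- s x]).
Proof.
move=> PTs PTf; have pf := PT_size PTf.
apply: (@PT_foldr _ _ (code_seq C) s (fun=> [::]) (fun x y t => f x y :: t)
  (fun z => csize (f z.1 z.2) + 1)) => //.
- exact: PT_const.
- apply: (@PT_cons _ _ (fun z : code_prod A (code_prod B (code_seq C)) => f z.1 z.2.1)
            (fun z => z.2.2)); last by pt_atom.
  by apply: (PT2_app PTf); pt_atom.
- by apply: pboundD => //; apply: pbound_const.
by move=> x a y; rewrite /csize /=; lia.
Qed.

Lemma PT_filter (s : A -> seq B) (f : A -> B -> bool) :
    PT (B := code_seq B) s -> PT2 f ->
  PT (B := code_seq B) (fun x => [seq y <- s x | f x y]).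
Proof.
move=> PTs PTf.
apply: (@PT_foldr _ _ (code_seq B) s (fun=> [::])
  (fun x y t => if f x y then y :: t else t)
  (fun z => csize z)) => //.
- exact: PT_const.
- apply: (@PT_if _ _ (fun z : code_prod A (code_prod B (code_seq B)) => f z.1 z.2.1)
            (fun z => z.2.1 :: z.2.2) (fun z => z.2.2)); last by pt_atom.
    by apply: (PT2_app PTf); pt_atom.
  by apply: PT_cons; pt_atom.
- exact: pbound_size.
by move=> x a y; case: ifP; rewrite /csize /=; lia.
Qed.

Lemma csize_cat (s t : seq B) : csize (s ++ t) <= csize s + csize t.
Proof. by rewrite /csize /=; elim: s => /= [|x s IH]; lia. Qed.

Lemma PT_cat (s t : A -> seq B) :
    PT (B := code_seq B) s -> PT (B := code_seq B) t ->
  PT (B := code_seq B) (fun x => s x ++ t x).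
Proof.
move=> PTs PTt.
have h : PT (B := code_seq B) (fun x => foldr cons (t x) (s x)).
  apply: (@PT_foldr _ _ (code_seq B) s t (fun _ y t => y :: t)
    (fun z => csize z)) => //.
  - by apply: PT_cons; pt_atom.
  - exact: pbound_size.
  by move=> x a y; rewrite /csize /=; lia.
by apply: PT_ext h => x; elim: (s x) => //= y r ->.
Qed.

End MapFilter.

Section Connectives.
Variables A B C : code.

Lemma PT_flatten_map (s : A -> seq B) (f : A -> B -> seq C) :
    PT (B := code_seq B) s -> PT2 (C := code_seq C) f ->
  PT (B := code_seq C) (fun x => flatten [seq f x y | y <- s x]).
Proof.
move=> PTs PTf; have pf := PT_size PTf.
have h : PT (B := code_seq C) (fun x => foldr (fun y t => f x y ++ t) [::] (s x)).
  apply: (@PT_foldr _ _ (code_seq C) s (fun=> [::]) (fun x y t => f x y ++ t)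
   (fun z => csize (f z.1 z.2))) => //.
  - exact: PT_const.
  - apply: (@PT_cat _ _ (fun z : code_prod A (code_prod B (code_seq C)) => f z.1 z.2.1)
            (fun z => z.2.2)); last by pt_atom.
    by apply: (PT2_app PTf); pt_atom.
  by move=> x a y; rewrite addnC; apply: csize_cat.
by apply: PT_ext h => x; elim: (s x) => //= y r ->.
Qed.

Lemma PT_andb (a b : A -> bool) : PT a -> PT b -> PT (fun x => a x && b x).
Proof. by move=> ha hb; apply: (PT_if ha hb); apply: PT_const. Qed.

Lemma PT_orb (a b : A -> bool) : PT a -> PT b -> PT (fun x => a x || b x).
Proof. by move=> ha hb; apply: (PT_if (f := fun=> true) ha (PT_const _ _) hb). Qed.

Lemma PT_negb (a : A -> bool) : PT a -> PT (fun x => ~~ a x).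
Proof. by move=> ha; apply: (PT_if ha); apply: PT_const. Qed.

Lemma PT_addb (a b : A -> bool) : PT a -> PT b -> PT (fun x => a x (+) b x).
Proof.
by move=> ha hb; apply: PT_ext (PT_if ha (PT_negb hb) hb) => x; case: (a x).
Qed.

Lemma PT_head (d : B) (s : A -> seq B) :
  PT (B := code_seq B) s -> PT (fun x => head d (s x)).
Proof.
move=> hs; apply: (PT_seq_case (f := fun=> d) (g := fun _ y _ => y) hs);
  first exact: PT_const.
by rewrite /PT3; pt_atom.
Qed.

Lemma PT_behead (s : A -> seq B) :
  PT (B := code_seq B) s -> PT (B := code_seq B) (fun x => behead (s x)).
Proof.
move=> hs; have h : PT (B := code_seq B) (fun x => if s x is _ :: r then r else [::]).
  apply: (PT_seq_case (f := fun=> [::]) (g := fun _ _ r => r) hs);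
    first exact: PT_const.
  by rewrite /PT3; pt_atom.
by apply: PT_ext h => x; case: (s x).
Qed.

End Connectives.

Section ListPredicates.
Variables A B C : code.

Lemma PT_all (s : A -> seq B) (f : A -> B -> bool) :
    PT (B := code_seq B) s -> PT2 f -> PT (fun x => all (f x) (s x)).
Proof.
move=> PTs PTf.
have h : PT (fun x => foldr (fun y t => f x y && t) true (s x)).
  apply: (@PT_foldr _ _ code_bool s (fun=> true) (fun x y t => f x y && t)
   (fun z => 2)) => //.
  - exact: PT_const.
  - by apply: PT_andb; [apply: (PT2_app PTf); pt_atom|pt_atom].
  - exact: pbound_const.
  by move=> x a y; rewrite /csize /=; case: (f x y); case: a.
by apply: PT_ext h => x; elim: (s x) => //= y r ->.
Qed.

End ListPredicates.

(** * Binary arithmetic *)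

Lemma bitsE n : 0 < n -> bits n = odd n :: bits n./2.
Proof.
move=> n_gt0; rewrite /bits up_log2S //= divn1; congr cons.
rewrite -[1]addn0 iotaDl -map_comp; apply: eq_map => i /=.
by rewrite expnS divnMA divn2.
Qed.

Fixpoint bval (s : seq bool) : nat :=
  if s is b :: r then b + (bval r).*2 else 0.

(** Bits come least significant first, so leading zeros sit at the end of the list; removing them
    gives the canonical encoding of the value. *)
Definition trim (s : seq bool) : seq bool :=
  foldr (fun b t => if t is _ :: _ then b :: t else if b then [:: b] else [::])
    [::] s.

Lemma bits_bval s : bits (bval s) = trim s.
Proof.
elim: s => [|b s IH] //=; rewrite -IH.
have [/eqP|v_gt0] := posnP (bval s).
  by move/eqP=> ->; case: b => //=; rewrite bitsE.
rewrite (@bitsE (bval s)) // bitsE; last by case: b => //; rewrite double_gt0.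
rewrite oddD odd_double addbF oddb half_bit_double (bitsE v_gt0) //.
Qed.

Lemma bval_bits n : bval (bits n) = n.
Proof.
elim/ltn_ind: n => n IH; have [->//|n_gt0] := posnP n.
by rewrite bitsE //= IH ?odd_double_half //; lia.
Qed.

Ltac pt_step :=
  match goal with
  | |- _ => pt_atom
  | |- _ => exact: PT_const
  | H : PT ?f |- _ => is_var f; first [exact: H | apply: (PT_comp H)]
  | H : PT2 ?f |- _ => is_var f; apply: (PT2_app H)
  | |- PT2 _ => rewrite /PT2
  | |- PT3 _ => rewrite /PT3
  | |- PT (fun _ => (_, _)) => apply: PT_pair
  | |- PT (fun _ => _ :: _) => apply: PT_cons
  | |- PT (fun _ => if _ then _ else _) => apply: PT_if
  | |- PT (fun _ => _ && _) => apply: PT_andb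
  | |- PT (fun _ => _ || _) => apply: PT_orb
  | |- PT (fun _ => ~~ _) => apply: PT_negb
  | |- PT (fun _ => _ (+) _) => apply: PT_addb
  | |- PT (fun _ => head _ _) => apply: PT_head
  | |- PT (fun _ => behead _) => apply: PT_behead
  | |- PT (fun _ => rev _) => apply: PT_rev
  | |- PT (fun _ => _ ++ _) => apply: PT_cat
  | |- PT (fun _ => flatten _) => apply: PT_flatten_map
  | |- PT (fun _ => map _ _) => apply: PT_map
  | |- PT (fun _ => filter _ _) => apply: PT_filter
  | |- PT (fun _ => all _ _) => apply: PT_all
  | |- PT (fun _ => _.1) => apply: PT_fst
  | |- PT (fun _ => _.2) => apply: PT_snd
  end.

Ltac pt := repeat pt_step.

Notation bitseq_code := (code_seq code_bool).

(* The state holds the unread bits of b, the carry and the reversed output. *)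
Definition add_step (st : seq bool * (bool * seq bool)) (x : bool) :=
  let y := head false st.1 in let c := st.2.1 in
  (behead st.1, ((x && y) || (c && (x || y)), (x (+) y (+) c) :: st.2.2)).

(** Padding a with as many zeros as b has bits makes the fold consume all of b; the final carry
    becomes the top bit. *)
Definition add_bits (a b : seq bool) : seq bool :=
  let st := foldl add_step (b, (false, [::])) (a ++ [seq false | _ <- b]) in
  rev (st.2.1 :: st.2.2).

Lemma bval_rcons s b : bval (rcons s b) = bval s + b * 2 ^ size s.
Proof. by elim: s => [|c s IH] /=; [lia|rewrite IH expnS; lia]. Qed.

Lemma bval_add_steps r b c o : size b <= size r ->
  let st := foldl add_step (b, (c, o)) r in
  bval (rev (st.2.1 :: st.2.2)) =
  bval (rev o) + 2 ^ size o * (c + bval r + bval b).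
Proof.
elim: r b c o => [|x r IH] b c o.
  by case: b => //= _; rewrite rev_cons bval_rcons size_rev; lia.
move=> le /=; rewrite {}IH; last by case: b le.
rewrite rev_cons bval_rcons size_rev /= expnS.
set u := 2 ^ size o; set v := bval (rev o).
have -> : bval b = head false b + (bval (behead b)).*2 by case: (b).
by clear; case: x; case: c; case: (head false b) => /=; nia.
Qed.

Lemma bval_add_bits a b : bval (add_bits a b) = bval a + bval b.
Proof.
rewrite /add_bits bval_add_steps ?size_cat ?size_map ?leq_addl //=.
have -> : bval (a ++ [seq false | _ <- b]) = bval a.
  by elim: a => /= [|x a ->] //; elim: b => //= y b ->.
by rewrite mul1n add0n.
Qed.

Lemma PT_bits (A : code) (f : A -> nat) :
  PT f -> PT (B := bitseq_code) (fun x => bits (f x)).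
Proof. exact: PT_enc_eq. Qed.

Lemma PT_trim (A : code) (s : A -> seq bool) :
  PT (B := bitseq_code) s -> PT (B := bitseq_code) (fun x => trim (s x)).
Proof.
move=> PTs.
apply: (@PT_foldr _ _ bitseq_code s (fun=> [::])
  (fun _ b t => if t is _ :: _ then b :: t else if b then [:: b] else [::])
  (fun z => csize z)) => //; first exact: PT_const.
- apply: (@PT_seq_case (code_prod A (code_prod code_bool bitseq_code)) _
     bitseq_code (fun z => z.2.2)
     (fun z => if z.2.1 then [:: z.2.1] else [::])
     (fun z _ _ => z.2.1 :: z.2.2)); first by pt.
    by apply: PT_if; pt.
  by rewrite /PT3; pt.
- exact: pbound_size.
by move=> x [|c t] [] //; rewrite /csize /=; lia.
Qed.

Lemma PT_bval (A : code) (s : A -> seq bool) :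
  PT (B := bitseq_code) s -> PT (fun x => bval (s x)).
Proof.
move=> PTs; apply: PT_enc_eq (PT_trim PTs) => x.
by rewrite -bits_bval.
Qed.

Lemma csize_bit (b : bool) : csize b = b.*2.+1.
Proof. by case: b. Qed.

Lemma csize_pair (A B : code) (x : A) (y : B) :
  csize (x, y) = (csize x + csize y).+1.
Proof. by []. Qed.

Lemma csize_cons (A : code) (x : A) (s : seq A) :
  csize (x :: s) = (csize x + csize s).+1.
Proof. by []. Qed.

Lemma csize_behead (A : code) (s : seq A) : csize (behead s) <= csize s.
Proof. by case: s => //= y r; rewrite csize_cons; lia. Qed.

Lemma PT_add_bits : PT2 (C := bitseq_code) add_bits.
Proof.
rewrite /PT2 /add_bits.
have h : PT (B := code_prod bitseq_code (code_prod code_bool bitseq_code))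
   (fun z : code_prod bitseq_code bitseq_code =>
    foldl add_step (z.2, (false, [::])) (z.1 ++ [seq false | _ <- z.2])).
  apply: (@PT_foldl _ code_bool
    (code_prod bitseq_code (code_prod code_bool bitseq_code))
     (fun z => z.1 ++ [seq false | _ <- z.2]) (fun z => (z.2, (false, [::])))
     (fun _ st x => add_step st x) (fun=> 10)).
  - pt; exact: PT_const.
  - pt.
  - rewrite /PT3 /add_step; pt.
  - exact: pbound_const.
  move=> _ [b [c o]] x; rewrite /add_step /= !csize_pair csize_cons !csize_bit.
  have := csize_behead b; move: (csize (behead b)) (csize b) (csize o) => u v w.
  by case: x; case: c; case: (head _ _) => /=; lia.
exact: PT_rev (PT_cons (PT_fst (PT_snd h)) (PT_snd (PT_snd h))).
Qed.

Lemma PT2_addn : PT2 addn.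
Proof.
have h : PT (fun z : code_prod code_nat code_nat =>
               bval (add_bits (bits z.1) (bits z.2))).
  apply: PT_bval; apply: (PT2_app PT_add_bits); apply: PT_bits; pt.
by apply: PT_ext h => z; rewrite bval_add_bits !bval_bits.
Qed.

(** Reading from the least significant end, the last differing pair of bits decides, so each
    difference overrides the verdict so far; the initial [true] is the answer for equal numbers. *)
Definition leq_step (st : seq bool * bool) (x : bool) :=
  let y := head false st.1 in (behead st.1, if x (+) y then y else st.2).

Definition leq_bits (a b : seq bool) : bool :=
  (foldl leq_step (b, true) (a ++ [seq false | _ <- b])).2.

Lemma leq_stepsE r b f : size b <= size r ->
  (foldl leq_step (b, f) r).2 =
  if bval r == bval b then f else bval r < bval b.
Proof.
elim: r b f => [|x r IH] b f; first by case: b.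
move=> le /=; rewrite {}IH; last by case: b le.
have -> : bval b = head false b + (bval (behead b)).*2 by case: (b).
by clear; case: (head false b) => /=; case: x => /=; do 2?case: eqP; lia.
Qed.

Lemma leq_bitsE a b : leq_bits a b = (bval a <= bval b).
Proof.
rewrite /leq_bits leq_stepsE ?size_cat ?size_map ?leq_addl //=.
have -> : bval (a ++ [seq false | _ <- b]) = bval a.
  by elim: a => /= [|x a ->] //; elim: b => //= y b ->.
by case: eqP; lia.
Qed.

Lemma PT_leq_bits : PT2 leq_bits.
Proof.
rewrite /PT2 /leq_bits.
apply: PT_snd.
apply: (@PT_foldl _ code_bool (code_prod bitseq_code code_bool)
     (fun z : code_prod bitseq_code bitseq_code =>
        z.1 ++ [seq false | _ <- z.2]) (fun z => (z.2, true))
     (fun _ st x => leq_step st x) (fun=> 10)).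
- pt; exact: PT_const.
- pt.
- rewrite /PT3 /leq_step; pt.
- exact: pbound_const.
move=> _ [b c] x; rewrite /leq_step /= !csize_pair !csize_bit.
have := csize_behead b; move: (csize (behead b)) (csize b) => u v.
by case: x; case: c; case: (head _ _) => /=; lia.
Qed.

Lemma PT2_leq : PT2 leq.
Proof.
have h : PT (fun z : code_prod code_nat code_nat => leq_bits (bits z.1) (bits z.2)).
  apply: (PT2_app PT_leq_bits); apply: PT_bits; pt.
by apply: PT_ext h => z; rewrite leq_bitsE !bval_bits.
Qed.

Lemma PT_addn (A : code) (f g : A -> nat) : PT f -> PT g -> PT (fun x => f x + g x).
Proof. exact: PT2_app PT2_addn. Qed.

Lemma PT_leq (A : code) (f g : A -> nat) : PT f -> PT g -> PT (fun x => f x <= g x).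
Proof. exact: PT2_app PT2_leq. Qed.

Lemma PT_eqn (A : code) (f g : A -> nat) : PT f -> PT g -> PT (fun x => f x == g x).
Proof.
move=> hf hg; apply: PT_ext (PT_andb (PT_leq hf hg) (PT_leq hg hf)) => x.
by rewrite eqn_leq.
Qed.

Lemma PT_succ (A : code) (f : A -> nat) : PT f -> PT (fun x => (f x).+1).
Proof.
by move=> hf; apply: PT_ext (PT_addn hf (PT_const A 1)) => x; rewrite addn1.
Qed.

Lemma PT_ltn (A : code) (f g : A -> nat) : PT f -> PT g -> PT (fun x => f x < g x).
Proof. by move=> hf hg; apply: PT_leq hg; apply: PT_succ. Qed.

Lemma csize_nat (n : nat) : csize n = if n == 0 then 1 else csize n./2 + (odd n).*2 + 2.
Proof.
case: eqP => [->//|/eqP]; rewrite -lt0n => n_gt0.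
by rewrite /csize /= /enc_nat bitsE //=; case: (odd n) => /=; lia.
Qed.

(** Together with [csize_addn], this makes counters and running sums admissible as fold
    accumulators. *)
Lemma csize_succ (n : nat) : csize n.+1 <= csize n + 4.
Proof.
elim/ltn_ind: n => n IH; rewrite csize_nat [csize n]csize_nat /=.
case: eqP => [->//|/eqP]; rewrite -lt0n => n_gt0.
rewrite uphalf_half; case On: (odd n) => /=; last by rewrite add0n; lia.
by have := IH n./2; rewrite add1n; lia.
Qed.

Lemma csize_addn (m n : nat) : csize (m + n) <= csize m + csize n.
Proof.
elim/ltn_ind: m n => m IH n.
have [->|m_gt0] := posnP m; first by rewrite add0n leq_addl.
have [->|n_gt0] := posnP n; first by rewrite addn0 leq_addr.
rewrite csize_nat [csize m]csize_nat [csize n]csize_nat.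
have -> : (m + n == 0) = false by lia.
have -> : (m == 0) = false by lia.
have -> : (n == 0) = false by lia.
have := IH m./2 _ n./2; have := csize_succ (m./2 + n./2).
rewrite halfD oddD; case: (odd m); case: (odd n) => /=; rewrite ?add0n ?add1n; lia.
Qed.

Ltac pt_nat_step :=
  match goal with
  | |- _ => pt_step
  | |- PT (fun _ => @eq_op _ _ _) => apply: PT_eqn
  | |- PT (fun _ => _ < _) => apply: PT_ltn
  | |- PT (fun _ => _ <= _) => apply: PT_leq
  | |- PT (fun _ => _.+1) => apply: PT_succ
  | |- PT (fun _ => _ + _) => apply: PT_addn
  end.

Ltac pt_nat := repeat pt_nat_step.

(** * Counting, summing and indexing in lists *)

Section NatLists.
Variables A B : code.

Lemma PT_count (s : A -> seq B) (f : A -> B -> bool) :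
    PT (B := code_seq B) s -> PT2 f -> PT (fun x => count (f x) (s x)).
Proof.
move=> PTs PTf.
have h : PT (fun x => foldr (fun y n => if f x y then n.+1 else n) 0 (s x)).
  apply: (@PT_foldr _ _ code_nat s (fun=> 0)
    (fun x y n => if f x y then n.+1 else n) (fun=> 4)) => //.
  - exact: PT_const.
  - by rewrite /PT3; pt_nat.
  - exact: pbound_const.
  by move=> x a y; case: ifP => _; [apply: csize_succ|apply: leq_addr].
by apply: PT_ext h => x; elim: (s x) => //= y r ->; case: (f x y).
Qed.

Lemma PT_size_seq (s : A -> seq B) :
  PT (B := code_seq B) s -> PT (fun x => size (s x)).
Proof.
move=> PTs.
by apply: PT_ext (PT_count (f := fun _ _ => true) PTs (PT_const _ _)) => x;
  rewrite count_predT.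
Qed.

Lemma PT_sum (s : A -> seq B) (P : A -> B -> bool) (F : A -> B -> nat) :
    PT (B := code_seq B) s -> PT2 P -> PT2 F ->
  PT (fun x => \sum_(y <- s x | P x y) F x y).
Proof.
move=> PTs PTP PTF; have pF := PT_size PTF.
have h : PT (fun x => foldr (fun y n => if P x y then F x y + n else n) 0 (s x)).
  apply: (@PT_foldr _ _ code_nat s (fun=> 0)
    (fun x y n => if P x y then F x y + n else n) (fun z => csize (F z.1 z.2))) => //.
  - exact: PT_const.
  - by rewrite /PT3; pt_nat.
  move=> x a y; case: ifP => _; last exact: leq_addr.
  by rewrite addnC csize_addn.
apply: PT_ext h => x; elim: (s x) => [|y r IH]; first by rewrite big_nil.
by rewrite big_cons /= IH.
Qed.

Lemma PT_bigmax (s : A -> seq B) (P : A -> B -> bool) (F : A -> B -> nat) :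
    PT (B := code_seq B) s -> PT2 P -> PT2 F ->
  PT (fun x => \max_(y <- s x | P x y) F x y).
Proof.
move=> PTs PTP PTF; have pF := PT_size PTF.
pose st x y n := if P x y then if F x y < n then n else F x y else n.
have h : PT (fun x => foldr (st x) 0 (s x)).
  apply: (@PT_foldr _ _ code_nat s (fun=> 0) st (fun z => csize (F z.1 z.2))) => //.
  - exact: PT_const.
  - by rewrite /PT3 /st; pt_nat.
  by move=> x a y; rewrite /st /=; do 2?case: ifP => _; rewrite ?leq_addr ?leq_addl.
apply: PT_ext h => x; elim: (s x) => [|y r IH]; first by rewrite big_nil.
by rewrite big_cons /= IH.
Qed.

Lemma PT_minn (s : A -> seq nat) (d : A -> nat) :
  PT (B := code_seq code_nat) s -> PT d -> PT (fun x => foldr minn (d x) (s x)).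
Proof.
move=> PTs PTd.
apply: (@PT_foldr _ _ code_nat s d (fun _ => minn) (fun z => csize z.2)) => //.
- by rewrite /PT3 /minn; pt_nat.
- by apply: leq_pbound (@pbound_size _ _) _ => -[x y]; rewrite csize_pair /=; lia.
by move=> x a y; rewrite /minn; case: ifP => _; rewrite ?leq_addr ?leq_addl.
Qed.

Lemma PT_index (a : A -> nat) (s : A -> seq nat) :
  PT a -> PT (B := code_seq code_nat) s -> PT (fun x => index (a x) (s x)).
Proof.
move=> PTa PTs.
apply: (@PT_foldr _ _ code_nat s (fun=> 0)
   (fun x y n => if y == a x then 0 else n.+1) (fun=> 4)) => //.
- exact: PT_const.
- by rewrite /PT3; pt_nat; apply: PT_const.
- exact: pbound_const.
by move=> x n y; case: ifP => _; [rewrite addnS|apply: csize_succ].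
Qed.

Lemma PT_nth (d : B) (s : A -> seq B) (i : A -> nat) :
  PT (B := code_seq B) s -> PT i -> PT (fun x => nth d (s x) (i x)).
Proof.
move=> PTs PTi.
pose st x (z : nat * B) y := (z.1.+1, if z.1 == i x then y else z.2).
have h : PT (B := code_prod code_nat B) (fun x => foldl (st x) (0, d) (s x)).
  apply: (@PT_foldl _ _ (code_prod code_nat B) s (fun=> (0, d)) st
    (fun z => csize z.2 + 4)) => //.
  - by apply: PT_const.
  - by rewrite /PT3 /st; pt_nat.
  - by apply: leq_pbound (pboundD (@pbound_size _ _) (pbound_const _ 4)) _ => -[x y];
     rewrite csize_pair /=; lia.
  move=> x [k v] y; rewrite /st /= !csize_pair; have := csize_succ k.
  by case: ifP => _ /=; lia.
apply: PT_ext (PT_snd h) => x.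
(* Once the counter has passed [i x] the stored value is final; until then it is still the
   default. *)
have E r : forall k v, (foldl (st x) (k, v) r).2 =
                       if i x < k then v else nth v r (i x - k).
  elim: r => [|y r IH] k v /=; first by rewrite nth_nil if_same.
  rewrite IH ltnS /=; case: (ltngtP k (i x)) => [lt|gt|->].
  - by rewrite subnS; have -> : i x - k = (i x - k).-1.+1 by lia.
  - by [].
  by rewrite subnn.
by rewrite E subn0.
Qed.

End NatLists.

Lemma csize_leq (n : nat) : csize n <= 4 * n + 1.
Proof.
elim: n => // n IH; apply: leq_trans (csize_succ n) _; lia.
Qed.

Section Iota.
Variables A B : code.

(* The guard bounds the growth of the accumulator; it never fails. *)
Lemma PT_iota (s : A -> seq B) :
  PT (B := code_seq B) s -> PT (B := code_seq code_nat) (fun x => iota 0 (size (s x))).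
Proof.
move=> PTs; have PTn := PT_size_seq PTs; have ps := PT_size PTs.
pose st x (t : seq nat) (_ : B) :=
  if size t <= size (s x) then t ++ [:: size t] else t.
have PTst : PT3 (C := B) (D := code_seq code_nat) (B := code_seq code_nat) st.
  rewrite /PT3 /st.
  have PTt : PT (A := code_prod A (code_prod (code_seq code_nat) B))
                  (fun z => size z.2.1).
    by apply: PT_size_seq; pt.
  apply: PT_if; [apply: PT_leq|apply: PT_cat|]; pt => //.
  by apply: (PT_comp PTn); pt.
have h : PT (B := code_seq code_nat) (fun x => foldl (st x) [::] (s x)).
  apply: (@PT_foldl _ _ (code_seq code_nat) s (fun=> [::]) st
    (fun z => 4 * csize (s z.1) + 10)) => //.
  - exact: PT_const.
  - apply: pboundD; last exact: pbound_const.
    apply: pboundM; first exact: pbound_const.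
    apply: (pbound_comp (f := fst) ps).
    by apply: leq_pbound (@pbound_size _ _) _ => -[x y]; rewrite csize_pair /=; lia.
  move=> x t y; rewrite /st /=; case: ifP => [le|_]; last by lia.
  apply: leq_trans (csize_cat _ _) _; rewrite leq_add2l csize_cons.
  move: (csize_leq (size t)) (size_csize (s x)) => h1 h2; move: h1 h2 le.
  have -> : csize ([::] : seq nat) = 1 by [].
  by move: (size t) (csize (size t)) (size (s x)) (csize (s x)) => *; lia.
apply: PT_ext h => x.
have E r : forall k, k + size r <= size (s x) ->
    foldl (st x) (iota 0 k) r = iota 0 (k + size r).
  elim: r => [|y r IH] k /=; first by rewrite addn0.
  move=> le; rewrite /st size_iota ifT; last by lia.
  by rewrite -[k in [:: k]]add0n -(iotaD 0 k 1) addn1 IH ?addSnnS //; lia.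
by rewrite (E _ 0).
Qed.

End Iota.

(** * The algorithm *)

(* (numerator and denominator of alpha, (candidates, (votes, (prices, p)))) *)
Definition input : code :=
  code_prod (code_prod code_nat code_nat)
    (code_prod (code_seq code_nat)
      (code_prod (code_seq (code_seq code_nat))
        (code_prod (code_seq (code_seq code_nat)) code_nat))).

Section Algorithm.
Variable x : input.

Definition num : nat := x.1.1.
Definition den : nat := x.1.2.
Definition cands : seq nat := x.2.1.
Definition ballots : seq (seq nat) := x.2.2.1.
Definition tariffs : seq (seq nat) := x.2.2.2.1.
Definition pref : nat := x.2.2.2.2.

Definition voters : seq nat := iota 0 (size ballots).
Definition pos (c j : nat) : nat := index c (nth [::] ballots j).
(** The truncated difference of the positions of [pref] and c, with counting in place of
    subtraction. *)
Definition need (c j : nat) : nat :=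
  count (fun k => k + pos c j < pos pref j) (iota 0 (size (nth [::] ballots j))).
Definition price (c j : nat) : nat := nth 0 (nth [::] tariffs j) (need c j).
Definition before (c i j : nat) : bool :=
  (price c i < price c j) || ((price c i == price c j) && (i <= j)).
Definition prefix_cost (c j : nat) : nat :=
  \sum_(i <- voters | before c i j) price c i.
Definition lift (D j : nat) : nat :=
  \max_(c <- cands | prefix_cost c j <= D) need c j.

(** Pairwise preference after the shift, read off from the original positions without building the
    shifted vote; [prefers_shift_up] justifies the three cases. *)
Definition above (D a b j : nat) : bool :=
  if a == pref then pos pref j <= lift D j + pos b j
  else if b == pref then lift D j + pos a j < pos pref j
  else pos a j < pos b j.
Definition support (D a b : nat) : nat := count (above D a b) voters.
(* Copeland scores multiplied by the denominator of alpha. *)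
Definition score (D a : nat) : nat :=
  \sum_(b <- cands | b != a)
    (if support D b a < support D a b then den
     else if support D a b == support D b a then num else 0).
Definition wins (D : nat) : bool :=
  all (fun b => score D b <= score D pref) cands.

(** [lift D] changes only when D crosses a prefix cost, so these values represent all budgets; 0
    stands for budgets below every prefix cost. *)
Definition budgets : seq nat :=
  0 :: flatten [seq [seq prefix_cost c j | j <- voters] | c <- cands].
(** The default is itself a winning budget whenever there is one, so it cannot spoil the minimum. *)
Definition best : nat :=
  foldr minn (head 0 (filter wins budgets)) (filter wins budgets).
Definition solve : seq nat := [seq lift best j | j <- voters].

End Algorithm.

(** * Polynomial running time of the algorithm *)

Lemma PT_num : PT num. Proof. by rewrite /num; pt. Qed.
Lemma PT_den : PT den. Proof. by rewrite /den; pt. Qed.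
Lemma PT_cands : PT (B := code_seq code_nat) cands.
Proof. by rewrite /cands; pt. Qed.
Lemma PT_ballots : PT (B := code_seq (code_seq code_nat)) ballots.
Proof. by rewrite /ballots; pt. Qed.
Lemma PT_tariffs : PT (B := code_seq (code_seq code_nat)) tariffs.
Proof. by rewrite /tariffs; pt. Qed.
Lemma PT_pref : PT pref. Proof. by rewrite /pref; pt. Qed.
Lemma PT_voters : PT (B := code_seq code_nat) voters.
Proof. exact: PT_iota PT_ballots. Qed.

Lemma PT_pos (A : code) (x : A -> input) (a b : A -> nat) :
  PT x -> PT a -> PT b -> PT (fun z => pos (x z) (a z) (b z)).
Proof.
move=> PTx PTa PTb; apply: PT_index => //; apply: PT_nth => //.
exact: (PT_comp PT_ballots).
Qed.

Ltac pt_alg_step :=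
  match goal with
  | |- _ => pt_nat_step
  | |- PT (fun _ => num _) => apply: (PT_comp PT_num)
  | |- PT (fun _ => den _) => apply: (PT_comp PT_den)
  | |- PT (fun _ => pref _) => apply: (PT_comp PT_pref)
  | |- PT (fun _ => cands _) => apply: (PT_comp PT_cands)
  | |- PT (fun _ => voters _) => apply: (PT_comp PT_voters)
  | |- PT (fun _ => ballots _) => apply: (PT_comp PT_ballots)
  | |- PT (fun _ => tariffs _) => apply: (PT_comp PT_tariffs)
  | |- PT (fun _ => iota 0 (size _)) => apply: PT_iota
  | |- PT (fun _ => nth _ _ _) => apply: PT_nth
  | |- PT (fun _ => count _ _) => apply: PT_count
  | |- PT (fun _ => pos _ _ _) => apply: PT_pos
  | |- PT (fun _ => \sum_(_ <- _ | _) _) => apply: PT_sum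
  | |- PT (fun _ => \max_(_ <- _ | _) _) => apply: PT_bigmax
  | |- PT (fun _ => foldr minn _ _) => apply: PT_minn
  end.

Ltac pt_alg t := repeat first [pt_alg_step | t].

Lemma PT_need (A : code) (x : A -> input) (a b : A -> nat) :
  PT x -> PT a -> PT b -> PT (fun z => need (x z) (a z) (b z)).
Proof. by move=> *; rewrite /need; pt_alg ltac:(fail). Qed.

Ltac pt_need :=
  first [ match goal with |- PT (fun _ => need _ _ _) => apply: PT_need end ].

Lemma PT_price (A : code) (x : A -> input) (a b : A -> nat) :
  PT x -> PT a -> PT b -> PT (fun z => price (x z) (a z) (b z)).
Proof. by move=> *; rewrite /price; pt_alg ltac:(pt_need). Qed.

Ltac pt_price :=
  first [ pt_need
        | match goal with |- PT (fun _ => price _ _ _) => apply: PT_price end ].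

Lemma PT_before (A : code) (x : A -> input) (a b c : A -> nat) :
  PT x -> PT a -> PT b -> PT c -> PT (fun z => before (x z) (a z) (b z) (c z)).
Proof. by move=> *; rewrite /before; pt_alg ltac:(pt_price). Qed.

Ltac pt_before :=
  first [ pt_price
        | match goal with |- PT (fun _ => before _ _ _ _) => apply: PT_before end ].

Lemma PT_prefix_cost (A : code) (x : A -> input) (a b : A -> nat) :
  PT x -> PT a -> PT b -> PT (fun z => prefix_cost (x z) (a z) (b z)).
Proof. by move=> *; rewrite /prefix_cost; pt_alg ltac:(pt_before). Qed.

Ltac pt_prefix_cost :=
  first [ pt_before
        | match goal with |- PT (fun _ => prefix_cost _ _ _) => apply: PT_prefix_cost end ].

Lemma PT_lift (A : code) (x : A -> input) (a b : A -> nat) :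
  PT x -> PT a -> PT b -> PT (fun z => lift (x z) (a z) (b z)).
Proof. by move=> *; rewrite /lift; pt_alg ltac:(pt_prefix_cost). Qed.

Ltac pt_lift :=
  first [ pt_prefix_cost
        | match goal with |- PT (fun _ => lift _ _ _) => apply: PT_lift end ].

Lemma PT_above (A : code) (x : A -> input) (a b c d : A -> nat) :
  PT x -> PT a -> PT b -> PT c -> PT d ->
  PT (fun z => above (x z) (a z) (b z) (c z) (d z)).
Proof. by move=> *; rewrite /above; pt_alg ltac:(pt_lift). Qed.

Ltac pt_above :=
  first [ pt_lift
        | match goal with |- PT (fun _ => above _ _ _ _ _) => apply: PT_above end ].

Lemma PT_support (A : code) (x : A -> input) (a b c : A -> nat) :
  PT x -> PT a -> PT b -> PT c -> PT (fun z => support (x z) (a z) (b z) (c z)).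
Proof. by move=> *; rewrite /support; pt_alg ltac:(pt_above). Qed.

Ltac pt_support :=
  first [ pt_above
        | match goal with |- PT (fun _ => support _ _ _ _) => apply: PT_support end ].

Lemma PT_score (A : code) (x : A -> input) (a b : A -> nat) :
  PT x -> PT a -> PT b -> PT (fun z => score (x z) (a z) (b z)).
Proof. by move=> *; rewrite /score; pt_alg ltac:(pt_support). Qed.

Ltac pt_score :=
  first [ pt_support
        | match goal with |- PT (fun _ => score _ _ _) => apply: PT_score end ].

Lemma PT_wins (A : code) (x : A -> input) (a : A -> nat) :
  PT x -> PT a -> PT (fun z => wins (x z) (a z)).
Proof. by move=> *; rewrite /wins; pt_alg ltac:(pt_score). Qed.

Ltac pt_wins :=
  first [ pt_score
        | match goal with |- PT (fun _ => wins _ _) => apply: PT_wins end ].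

Lemma PT_budgets (A : code) (x : A -> input) :
  PT x -> PT (B := code_seq code_nat) (fun z => budgets (x z)).
Proof. by move=> *; rewrite /budgets; pt_alg ltac:(pt_wins). Qed.

Ltac pt_budgets :=
  first [ pt_wins
        | match goal with |- PT (fun _ => budgets _) => apply: PT_budgets end ].

Lemma PT_best (A : code) (x : A -> input) :
  PT x -> PT (fun z => best (x z)).
Proof. by move=> *; rewrite /best; pt_alg ltac:(pt_budgets). Qed.

Ltac pt_best :=
  first [ pt_budgets
        | match goal with |- PT (fun _ => best _) => apply: PT_best end ].

Lemma PT_solve (A : code) (x : A -> input) :
  PT x -> PT (B := code_seq code_nat) (fun z => solve (x z)).
Proof. by move=> *; rewrite /solve; pt_alg ltac:(pt_best). Qed.

(** * Approximation guarantee *)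

Section CheapestVoters.
Variables (n : nat) (y : 'I_n -> nat).

Definition cheaper (i j : 'I_n) : bool :=
  (y i < y j) || ((y i == y j) && (i <= j)).
Definition prefix_sum (j : 'I_n) : nat := \sum_(i | cheaper i j) y i.
Definition affordable (D : nat) : {set 'I_n} := [set j | prefix_sum j <= D].

(** Since j < n, this number encodes the lexicographic order on the pairs (price, index), which
    turns [cheaper] into a comparison of naturals. *)
Let rank (j : 'I_n) : nat := y j * n + j.

Lemma cheaperE i j : cheaper i j = (rank i <= rank j).
Proof.
rewrite /cheaper /rank; have := ltn_ord i; have := ltn_ord j.
move: (y i) (y j) (nat_of_ord i) (nat_of_ord j) => a b u v lt_v lt_u.
case: (ltngtP a b) => [lt|gt|->] /=; last by rewrite leq_add2l.
  by apply/esym; have := leq_mul lt (leqnn n); rewrite mulSn; lia.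
by apply/esym/negbTE; have := leq_mul gt (leqnn n); rewrite mulSn; lia.
Qed.

Lemma rank_inj : injective rank.
Proof.
move=> i j E; have := cheaperE i j; have := cheaperE j i.
rewrite E leqnn /cheaper; case: ltngtP => //= _ le_ji le_ij.
by apply/val_inj/anti_leq; rewrite le_ij le_ji.
Qed.

Lemma leq_prefix_sum i j : cheaper i j -> prefix_sum i <= prefix_sum j.
Proof.
rewrite cheaperE => le_ij; rewrite /prefix_sum [X in _ <= X](bigID (cheaper^~ i)) /=.
rewrite [X in _ <= X + _](eq_bigl (cheaper^~ i)) ?leq_addr // => k.
by rewrite andbC !cheaperE; case: leqP => //= le_ki; rewrite (leq_trans le_ki).
Qed.

(** All affordable voters precede the affordable voter of greatest rank, so their total is at most
    that voter's prefix sum. *)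
Lemma sum_affordable D : \sum_(j in affordable D) y j <= D.
Proof.
have [->|[j0 j0S]] := set_0Vmem (affordable D); first by rewrite big_set0.
case: (@arg_maxnP _ j0 (fun j => j \in affordable D) rank j0S) => j jS max_j.
have le_jD : prefix_sum j <= D by move: jS; rewrite inE.
apply: leq_trans le_jD; rewrite /prefix_sum [X in _ <= X](bigID (mem (affordable D))) /=.
rewrite (eq_bigl (fun i => cheaper i j && (i \in affordable D))) ?leq_addr // => i.
by rewrite cheaperE; case: (boolP (i \in _)) => [/max_j le|_]; rewrite ?andbF ?andbT.
Qed.

(* An exchange argument: the voters outside the affordable set are at least as *)
(* expensive as those inside it.                                               *)
Lemma card_affordable D (T : {set 'I_n}) :
  \sum_(j in T) y j <= D -> #|T| <= #|affordable D|.
Proof.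
set S := affordable D => le_TD; rewrite leqNgt; apply/negP => lt_ST.
have [i iT iS] : exists2 i, i \in T & i \notin S.
  have /subsetPn[i iT iS] : ~~ (T \subset S).
    by apply: contraL lt_ST => /subset_leq_card; rewrite leqNgt.
  by exists i.
case: (@arg_minnP _ i (fun i => i \notin S) rank iS) => j jS min_j.
have le_out k : k \notin S -> y j <= y k.
  by move=> /min_j; rewrite -cheaperE /cheaper => /orP[/ltnW|/andP[/eqP->]].
have le_in k : k \in S -> y k <= y j.
  move=> kS; rewrite leqNgt; apply: contra jS => lt_jk; rewrite inE.
  rewrite inE in kS; apply: leq_trans kS; apply: leq_prefix_sum.
  by rewrite /cheaper lt_jk.
(* By minimality of j every voter strictly before j lies in S, so S together with j covers the
   prefix of j, whose sum exceeds D. *)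
have lt_D : D < \sum_(k in S) y k + y j.
  have : D < prefix_sum j by rewrite ltnNge; move: jS; rewrite inE.
  move=> /leq_trans; apply; rewrite /prefix_sum (bigD1 j) /=; last first.
    by rewrite cheaperE.
  rewrite addnC leq_add2r [X in _ <= X](bigID (fun k => cheaper k j && (k != j))) /=.
  rewrite (eq_bigl (fun k => (k \in S) && (cheaper k j && (k != j)))) ?leq_addr // => k.
  case: (boolP (k \in S)) => //= kS; apply/negbTE; rewrite negb_and negbK.
  rewrite orbC -implyNb; apply/implyP => ne_kj; rewrite cheaperE -ltnNge.
  rewrite ltn_neqAle (min_j _ kS) andbT; apply: contra ne_kj => /eqP/rank_inj ->.
  by rewrite eqxx.
have sumS : \sum_(k in S) y k <= \sum_(k in S :&: T) y k + #|S :\: T| * y j.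
  rewrite (big_setID T) /= leq_add2l -sum_nat_const leq_sum // => k.
  by rewrite inE => /andP[_ /le_in].
have sumT : \sum_(k in S :&: T) y k + #|T :\: S| * y j <= \sum_(k in T) y k.
  rewrite [X in _ <= X](big_setID S) /= setIC leq_add2l -sum_nat_const leq_sum // => k.
  by rewrite inE => /andP[/le_out].
have lt_c : #|S :\: T| < #|T :\: S|.
  rewrite !cardsD setIC ltn_sub2r // (leq_trans _ lt_ST) // ltnS.
  by rewrite subset_leq_card ?subsetIr.
(* Trading S minus T and the extra voter j for the at least as numerous T minus S, at price [y j]
   each, shows that T costs more than D. *)
have := leq_mul lt_c (leqnn (y j)); rewrite mulSn.
move: lt_D sumS sumT le_TD; clear; lia.
Qed.

End CheapestVoters.

(** * Positions after a shift *)

Lemma index_insert (T : eqType) (p a : T) (o : seq T) k :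
    a != p -> a \in o ->
  index a (take k o ++ p :: drop k o) =
  if index a o < k then index a o else (index a o).+1.
Proof.
move=> ne_ap a_o; rewrite index_cat in_take //=.
rewrite [p == a]eq_sym (negPf ne_ap).
have [lt_k|le_k] := ltnP (index a o) k.
  rewrite -[in RHS](cat_take_drop k o) index_cat in_take //.
  by rewrite lt_k.
have k_o : k < size o by apply: leq_ltn_trans le_k _; rewrite index_mem.
rewrite -[in RHS](cat_take_drop k o) index_cat in_take // ltnNge le_k /=.
by rewrite addnS.
Qed.

Section ShiftUp.
Variables (m : nat) (p : 'I_m) (v : seq 'I_m).
Hypothesis lin_v : linear_order v.

Lemma linear_uniq : uniq v.
Proof. by rewrite (perm_uniq lin_v) enum_uniq. Qed.

Lemma linear_mem a : a \in v.
Proof. by rewrite (perm_mem lin_v) mem_enum. Qed.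

Lemma linear_size : size v = m.
Proof. by rewrite (perm_size lin_v) size_enum_ord. Qed.

Lemma linear_index_lt a : index a v < m.
Proof. by rewrite -[X in _ < X]linear_size index_mem linear_mem. Qed.

Lemma leq_size_rem : index p v <= size (rem p v).
Proof.
by rewrite size_rem ?linear_mem // linear_size; have := linear_index_lt p; lia.
Qed.

Lemma shift_up0 : shift_up p 0 v = v.
Proof.
have sz : size (take (index p v) v) = index p v.
  by rewrite size_takel // ltnW // index_mem linear_mem.
rewrite /shift_up subn0 remE -{1 3}sz take_size_cat // drop_size_cat //.
have -> : p :: drop (index p v).+1 v = drop (index p v) v.
  by rewrite [RHS](drop_nth p) ?index_mem ?linear_mem // nth_index ?linear_mem.
exact: cat_take_drop.
Qed.

Lemma mem_rem_neq a : a != p -> a \in rem p v.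
Proof. by move=> ne; rewrite mem_rem_uniq ?linear_uniq // inE ne linear_mem. Qed.

Lemma index_shift_up_pref k : index p (shift_up p k v) = index p v - k.
Proof.
rewrite /shift_up index_cat /= eqxx addn0.
have /negPf-> : p \notin take (index p v - k) (rem p v).
  apply/negP => /mem_take.
  by rewrite mem_rem_uniq ?linear_uniq // inE eqxx.
by rewrite size_takel // (leq_trans (leq_subr _ _)) ?leq_size_rem.
Qed.

Lemma index_shift_up k a : a != p ->
  index a (shift_up p k v) =
  let i := index a (rem p v) in if i < index p v - k then i else i.+1.
Proof. by move=> ne; rewrite /shift_up index_insert ?mem_rem_neq. Qed.

(** A vote is its own shift by 0, so positions before and after a shift are both expressed through
    the position among the other candidates. *)
Lemma index_rem a : a != p ->
  index a v =
  let i := index a (rem p v) in if i < index p v then i else i.+1.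
Proof. by move=> ne; rewrite -{1}shift_up0 index_shift_up ?subn0. Qed.

Lemma prefers_shift_up k a b : a != b ->
  prefers (shift_up p k v) a b =
  if a == p then index p v <= k + index b v
  else if b == p then k + index a v < index p v
  else index a v < index b v.
Proof.
rewrite /prefers; case: (eqVneq a p) => [->|ne_a] ne.
  rewrite eq_sym in ne.
  rewrite index_shift_up_pref index_shift_up // (index_rem ne) /=.
  move: (index p v) (index b (rem p v)) => u w.
  by case: (ltnP w (u - k)); case: (ltnP w u) => *; apply/idP/idP; lia.
case: (eqVneq b p) => [->|ne_b].
  rewrite index_shift_up_pref index_shift_up // (index_rem ne_a) /=.
  move: (index p v) (index a (rem p v)) => u w.
  by case: (ltnP w (u - k)); case: (ltnP w u) => *; apply/idP/idP; lia.
rewrite !index_shift_up // (index_rem ne_a) (index_rem ne_b) /=.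
move: (index p v) (index a (rem p v)) (index b (rem p v)) => u w z.
by case: (ltnP w (u - k)); case: (ltnP w u); case: (ltnP z (u - k));
  case: (ltnP z u) => *; apply/idP/idP; lia.
Qed.

Lemma linear_shift_up k : linear_order (shift_up p k v).
Proof.
rewrite /linear_order -(permPr lin_v) /shift_up -cat1s perm_catCA cat_take_drop.
by rewrite perm_sym perm_to_rem ?linear_mem.
Qed.

End ShiftUp.

(** * Monotonicity of Copeland scores *)

Section Copeland.
Variable alpha : rat.
Hypothesis alpha01 : (0 <= alpha <= 1)%R.

Definition pair_score (x y : nat) : rat :=
  if y < x then 1%R else if x == y then alpha else 0%R.

(** The bounds on [alpha] place a tie between a loss and a win. *)
Lemma leq_pair_score x x' y y' :
  x <= x' -> y' <= y -> (pair_score x y <= pair_score x' y')%R.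
Proof.
move: alpha01 => /andP[a0 a1]; rewrite /pair_score.
by case: (ltngtP y x); case: (ltngtP y' x') => //; lia.
Qed.

Lemma copeland_scoreE m n (V : profile m n) a :
  copeland_score alpha V a =
  (\sum_(b | b != a) pair_score (nprefer V a b) (nprefer V b a))%R.
Proof. by []. Qed.

(** A rival's new score is at most its old one, which is at most p's old score, which is at most p's
    new one. *)
Lemma copeland_mono m n (V W : profile m n) (p : 'I_m) :
    (forall a b, a != p -> b != p -> nprefer W a b = nprefer V a b) ->
    (forall c, c != p -> nprefer V p c <= nprefer W p c) ->
    (forall c, c != p -> nprefer W c p <= nprefer V c p) ->
  copeland alpha V p -> copeland alpha W p.
Proof.
move=> eqW leW geW /forallP win; apply/forallP => a.
have [->|ne_a] := eqVneq a p; first exact: lexx.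
apply: le_trans (le_trans (win a) _).
  rewrite !copeland_scoreE; apply: ler_sum => b ne_b.
  have [->|ne_bp] := eqVneq b p; first by apply: leq_pair_score; [exact: geW|exact: leW].
  by rewrite !eqW.
rewrite !copeland_scoreE; apply: ler_sum => b ne_b.
by apply: leq_pair_score; [exact: leW|exact: geW].
Qed.

(** [pair_score n 0] is the most a single contest can give; p obtains it in every contest, and all
    candidates have equally many opponents. *)
Lemma copeland_unanimous m n (V : profile m n) (p : 'I_m) :
    (forall c, c != p -> nprefer V p c = n) ->
    (forall c, c != p -> nprefer V c p = 0) -> copeland alpha V p.
Proof.
move=> np nc; apply/forallP => a; rewrite !copeland_scoreE.
rewrite [X in (_ <= X)%R](eq_bigr (fun=> pair_score n 0)); last first.
  by move=> b ne_b; rewrite np ?nc.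
apply: (@le_trans _ _ (\sum_(b | b != a) pair_score n 0)%R).
  apply: ler_sum => b _; apply: leq_pair_score => //.
  by rewrite -[X in _ <= X]card_ord max_card.
rewrite !sumr_const.
suff -> : #|(fun b : 'I_m => b != a)| = #|(fun b : 'I_m => b != p)| by [].
have E (c : 'I_m) : #|(fun b : 'I_m => b != c)| = m.-1.
  by rewrite -[in RHS](card_ord m) -(cardC1 c); apply: eq_card.
by rewrite !E.
Qed.

End Copeland.

Lemma nprefer_total m n (V : profile m n) a b :
  (forall i, linear_order (tnth V i)) -> a != b ->
  nprefer V a b + nprefer V b a = n.
Proof.
move=> lin ne; rewrite -[RHS]card_ord -(cardsC [set i | prefers (tnth V i) a b]).
congr addn; apply: eq_card => i; rewrite !inE /prefers -leqNgt.
rewrite [RHS]leq_eqVlt; case: eqP => // E; case/negP: ne; apply/eqP.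
by apply: (index_inj a) (esym E); apply: linear_mem (lin i) _.
Qed.

Lemma count_iota_ltn a b s :
  b <= s -> count (fun k => k + a < b) (iota 0 s) = b - a.
Proof.
have E k l : count (fun k => k + a < b) (iota k l) = minn l (b - a - k).
  elim: l k => [|l IH] k /=; first by rewrite min0n.
  by rewrite IH; case: ltnP => /=; lia.
by rewrite E; lia.
Qed.

(** * The algorithm on an encoded instance *)

Section Instance.
Variables (alpha : rat) (I : instance).
Hypothesis alpha01 : (0 <= alpha <= 1)%R.

Local Notation m := (ncand I).
Local Notation n := (nvoters I).
Local Notation p := (preferred I).
Local Notation v := (tnth (votes I)).
Local Notation pi := (tnth (prices I)).

Definition instance_input : input :=
  ((`|numq alpha|, `|denq alpha|),
   (map val (enum 'I_m),
     (map (map val) (votes I),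
       ([seq mkseq (pi i) (index p (v i)).+1 | i <- enum 'I_n], val p))))%N.

Local Notation x := instance_input.

Lemma enc_seq_map (S : Type) (T : code) (f : S -> T) (e : S -> data) s :
  (forall y, e y = enc (f y)) -> enc_seq e s = enc_seq (@enc T) (map f s).
Proof. by move=> ef; elim: s => //= y s ->; rewrite ef. Qed.

Lemma enc_instance_input : enc x = enc_input alpha I.
Proof.
rewrite /enc_input /=; congr (Node _ (Node _ (Node _ (Node _ _)))).
- by rewrite [RHS](@enc_seq_map _ code_nat val).
- rewrite [RHS](@enc_seq_map _ (code_seq code_nat) (map val)) // => w.
  by rewrite [LHS](@enc_seq_map _ code_nat val).
by rewrite [RHS](@enc_seq_map _ (code_seq code_nat)
  (fun i => mkseq (pi i) (index p (v i)).+1)).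
Qed.

Definition shift_need (c : 'I_m) (j : 'I_n) : nat := index p (v j) - index c (v j).
Definition shift_price (c : 'I_m) (j : 'I_n) : nat := pi j (shift_need c j).

Lemma votersE : voters x = map val (enum 'I_n).
Proof. by rewrite /voters /ballots /= size_map size_tuple val_enum_ord. Qed.

Lemma ballotE (j : 'I_n) : nth [::] (ballots x) j = map val (v j).
Proof.
by rewrite /ballots /= (nth_map [::]) ?size_tuple // -tnth_nth.
Qed.

Lemma posE (c : 'I_m) (j : 'I_n) : pos x c j = index c (v j).
Proof. by rewrite /pos ballotE index_map //; apply: val_inj. Qed.

Lemma needE (c : 'I_m) (j : 'I_n) : need x c j = shift_need c j.
Proof.
rewrite /need ballotE size_map /pref /= !posE count_iota_ltn //.
exact: index_size.
Qed.

Lemma priceE (c : 'I_m) (j : 'I_n) : price x c j = shift_price c j.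
Proof.
rewrite /price needE /tariffs /= (nth_map j) ?size_enum_ord // nth_ord_enum.
by rewrite nth_mkseq // ltnS /shift_need leq_subr.
Qed.

Lemma beforeE (c : 'I_m) (i j : 'I_n) :
  before x c i j = cheaper (shift_price c) i j.
Proof. by rewrite /before /cheaper !priceE. Qed.

Lemma prefix_costE (c : 'I_m) (j : 'I_n) :
  prefix_cost x c j = prefix_sum (shift_price c) j.
Proof.
rewrite /prefix_cost votersE big_map big_enum_cond /=.
by apply: eq_big => i; rewrite ?beforeE // priceE.
Qed.

Lemma liftE D (j : 'I_n) :
  lift x D j = \max_(c | j \in affordable (shift_price c) D) shift_need c j.
Proof.
rewrite /lift /cands /= big_map big_enum_cond /=.
by apply: eq_big => c; rewrite ?inE ?prefix_costE // needE.
Qed.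

Definition action (D : nat) : shift_action I := [tuple lift x D j | j < n].

Lemma tnth_action D j : tnth (action D) j = lift x D j.
Proof. by rewrite tnth_mktuple. Qed.

Lemma tnth_shf (t : shift_action I) j :
  tnth (shf t) j = shift_up p (tnth t j) (v j).
Proof. by rewrite tnth_mktuple. Qed.

Lemma supportE D (a b : 'I_m) :
  a != b -> support x D a b = nprefer (shf (action D)) a b.
Proof.
move=> ne; rewrite /support votersE -sum1_count big_map big_enum_cond /=.
rewrite /nprefer -sum1_card; apply: eq_bigl => j; rewrite !inE tnth_shf.
rewrite prefers_shift_up ?votes_linear // tnth_action.
by rewrite /above /pref /= !posE.
Qed.

(** For nonnegative [alpha], multiplying by the denominator turns [alpha] into its numerator, so
    integer scores compare like the rational ones. *)
Lemma scoreE D (a : 'I_m) :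
  ((score x D a)%:R =
   (den x)%:R * copeland_score alpha (shf (action D)) a :> rat)%R.
Proof.
rewrite /score /cands /= big_map big_enum_cond /= natr_sum mulr_sumr.
apply: eq_big => // b ne_b; rewrite !supportE // 1?eq_sym //.
case: ifP => _; first by rewrite mulr1.
case: ifP => _; last by rewrite mulr0.
rewrite /num /den /=.
have a0 : (0 <= alpha)%R by case/andP: alpha01.
have -> : (`|denq alpha|%N%:R = (denq alpha)%:~R :> rat)%R.
  by rewrite -[in RHS](gez0_abs (denq_ge0 _)).
have -> : (`|numq alpha|%N%:R = (numq alpha)%:~R :> rat)%R.
  by rewrite -[in RHS](@gez0_abs (numq alpha)) // numq_ge0.
by rewrite -{3}[alpha]divq_num_den mulrC divfK // intr_eq0 denq_neq0.
Qed.

Lemma winsE D : wins x D = successful (copeland alpha) (action D).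
Proof.
have den0 : (0 < (den x)%:R :> rat)%R by rewrite ltr0n absz_gt0 denq_neq0.
have E (b : 'I_m) : (score x D b <= score x D p) =
    (copeland_score alpha (shf (action D)) b
       <= copeland_score alpha (shf (action D)) p)%R.
  by rewrite -(ler_nat rat) !scoreE ler_pM2l.
rewrite /wins /cands all_map /pref; apply/allP/forallP => h b.
  by rewrite -E; apply: h; rewrite mem_enum.
by move=> _ /=; rewrite E.
Qed.

End Instance.

(** * Winning budgets, cost bound and optimum *)

Lemma foldr_minn_mem d s : d \in s -> foldr minn d s \in s.
Proof.
move=> ds; suff: foldr minn d s \in d :: s by rewrite inE => /orP[/eqP->|].
elim: s {ds} => [|y s IH]; first by rewrite inE.
rewrite /= /minn; case: ifP => _; first by rewrite !inE eqxx orbT.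
by move: IH; rewrite !inE => /orP[->|->]; rewrite ?orbT.
Qed.

Lemma foldr_minn_leq d s z : z \in s -> foldr minn d s <= z.
Proof.
elim: s => //= y s IH; rewrite inE geq_min => /orP[/eqP->|/IH->].
  by rewrite leqnn.
by rewrite orbT.
Qed.

Lemma best_spec (x : input) D : D \in budgets x -> wins x D ->
  wins x (best x) /\ best x <= D.
Proof.
move=> Dx wD; have Dg : D \in filter (wins x) (budgets x) by rewrite mem_filter wD.
split; last exact: foldr_minn_leq.
have : best x \in filter (wins x) (budgets x).
  apply: foldr_minn_mem; case: (filter _ _) Dg => // y s _.
  by rewrite inE eqxx.
by rewrite mem_filter => /andP[].
Qed.

Section Approximation.
Variables (alpha : rat) (I : instance).
Hypothesis alpha01 : (0 <= alpha <= 1)%R.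

Local Notation m := (ncand I).
Local Notation n := (nvoters I).
Local Notation p := (preferred I).
Local Notation v := (tnth (votes I)).
Local Notation pi := (tnth (prices I)).
Local Notation x := (instance_input alpha I).
Local Notation action := (action alpha I).

Lemma price0 j : pi j 0 = 0.
Proof. by case: (prices_cost j). Qed.

Lemma leq_price j k l : k <= l -> pi j k <= pi j l.
Proof.
case: (prices_cost j) => _ mono _; apply: (homo_leq (r := leq)) => //.
exact: leq_trans.
Qed.

Lemma price_min j k : pi j (minn k (index p (v j))) = pi j k.
Proof.
case: (prices_cost j) => _ _ const; rewrite /minn; case: ltnP => //.
rewrite leq_eqVlt => /orP[/eqP->//|lt]; exact/esym/const.
Qed.

(** In each vote the lift is 0 or one of the shifts bought there, so its price is at most the sum of
    their prices. Exchanging the sums leaves at most D for each candidate. *)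
Lemma cost_action D : cost (action D) <= m * D.
Proof.
have le_j j : pi j (tnth (action D) j) <=
    \sum_(c | j \in affordable (shift_price c) D) shift_price c j.
  rewrite tnth_action liftE.
  apply: (big_ind2 (fun a b => pi j a <= b)) => [|a b a' b' le le'|//].
    by rewrite price0.
  rewrite /maxn; case: ifP => _; first exact: leq_trans le' (leq_addl _ _).
  exact: leq_trans le (leq_addr _ _).
rewrite /cost; apply: leq_trans (leq_sum _ (fun j _ => le_j j)) _.
rewrite (exchange_big_dep predT) //=.
rewrite -[X in _ <= X * D](card_ord m) -sum_nat_const leq_sum // => c _.
exact: sum_affordable.
Qed.

Lemma nprefer_shf (t : shift_action I) (c : 'I_m) : c != p ->
  nprefer (shf t) p c = #|[set j | shift_need c j <= tnth t j]|.
Proof.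
move=> ne; apply: eq_card => j; rewrite !inE tnth_shf.
rewrite prefers_shift_up ?votes_linear 1?eq_sym // eqxx /shift_need.
by rewrite leq_subLR addnC.
Qed.

Lemma nprefer_shf_neq (t u : shift_action I) (a b : 'I_m) : a != p -> b != p ->
  nprefer (shf t) a b = nprefer (shf u) a b.
Proof.
move=> ne_a ne_b; have [->|ne] := eqVneq a b.
  by apply: eq_card => j; rewrite !inE /prefers !ltnn.
apply: eq_card => j; rewrite !inE !tnth_shf !prefers_shift_up ?votes_linear //.
by rewrite (negPf ne_a) (negPf ne_b).
Qed.

Lemma shf_linear (t : shift_action I) j : linear_order (tnth (shf t) j).
Proof. by rewrite tnth_shf; apply/linear_shift_up/votes_linear. Qed.

(** Only p's own support needs checking: contests without p are unaffected, and support against p is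
    the complement to n. *)
Lemma successful_mono (t u : shift_action I) :
    (forall c, c != p -> nprefer (shf t) p c <= nprefer (shf u) p c) ->
  successful (copeland alpha) t -> successful (copeland alpha) u.
Proof.
move=> le; apply: copeland_mono => // [a b ne_a ne_b|c ne]; first exact: nprefer_shf_neq.
have := le c ne; rewrite eq_sym in ne.
have := nprefer_total (shf_linear t) ne; have := nprefer_total (shf_linear u) ne.
lia.
Qed.

(** D is the largest listed budget within [cost t]; it affords exactly the prefixes that [cost t]
    itself affords. *)
Lemma wins_budget (t : shift_action I) : successful (copeland alpha) t ->
  exists2 D, D \in budgets x & wins x D /\ D <= cost t.
Proof.
move=> st; pose D := \max_(b <- budgets x | b <= cost t) b.
have Dx : D \in budgets x.
  rewrite /D big_seq_cond; apply: (big_ind (fun z => z \in budgets x)) => //.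
  - by move=> a b ax bx; rewrite /maxn; case: ifP.
  - by move=> b /andP[].
exists D => //; split; last by apply/bigmax_leqP_seq.
rewrite winsE //; apply: successful_mono st => c ne; rewrite !nprefer_shf //.
(* The votes where t puts p above c cost at most [cost t] when priced for c alone, by monotonicity
   of the prices. *)
apply: leq_trans (card_affordable (y := shift_price c) (D := cost t) _) _.
  rewrite /cost [X in _ <= X](bigID (mem [set j | shift_need c j <= tnth t j])) /=.
  apply: leq_trans (leq_addr _ _); apply: leq_sum => j; rewrite inE.
  exact: leq_price.
apply/subset_leq_card/subsetP => j; rewrite !inE tnth_action liftE => le.
apply: (leq_bigmax_cond (F := fun c => shift_need c j)); rewrite inE.
(* The prefix sum of j is itself a listed budget within [cost t], hence at most D. *)
apply: (leq_bigmax_seq (F := id)) => //; rewrite -(prefix_costE alpha) inE.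
apply/orP; right; apply/flatten_mapP; exists (val c).
  by apply: map_f; rewrite mem_enum.
by apply: map_f; rewrite votersE map_f ?mem_enum.
Qed.

Lemma successful_full :
  successful (copeland alpha) ([tuple index p (v j) | j < n] : shift_action I).
Proof.
set t : shift_action I := [tuple index p (v j) | j < n].
have E c : c != p -> nprefer (shf t) p c = n.
  move=> ne; rewrite nprefer_shf // -[RHS]card_ord; apply: eq_card => j.
  by rewrite !inE tnth_mktuple leq_subr.
apply: copeland_unanimous => // c ne; have := E _ ne; rewrite eq_sym in ne.
have := nprefer_total (shf_linear t) ne; lia.
Qed.

(** Truncating each shift where p reaches the top preserves cost and success and leaves finitely
    many actions; lifting p to the top everywhere shows that a successful one exists. *)
Lemma opt_exists : exists o, is_opt (copeland alpha) I o.
Proof.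
pose tup (f : {ffun 'I_n -> 'I_m}) : shift_action I := [tuple val (f j) | j < n].
have bound k j : minn k (index p (v j)) < m.
  by rewrite gtn_min (linear_index_lt (votes_linear j)) orbT.
pose trunc (t : shift_action I) := [ffun j => Ordinal (bound (tnth t j) j)].
have cost_trunc t : cost (tup (trunc t)) = cost t.
  by apply: eq_bigr => j _; rewrite tnth_mktuple ffunE price_min.
have succ_trunc t : successful (copeland alpha) t ->
    successful (copeland alpha) (tup (trunc t)).
  apply: successful_mono => c ne; rewrite !nprefer_shf // subset_leq_card //.
  apply/subsetP => j; rewrite !inE tnth_mktuple ffunE /= leq_min => ->.
  exact: leq_subr.
case: (@arg_minnP _ _ (fun f => successful (copeland alpha) (tup f))
        (fun f => cost (tup f)) (succ_trunc _ successful_full)) => f sf min_f.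
exists (cost (tup f)); split; first by exists (tup f).
by move=> t /succ_trunc/min_f; rewrite cost_trunc.
Qed.

End Approximation.

(** * Linking into a single program *)

Lemma PT_program (X Y : code) (f : X -> Y) : PT f ->
  exists (P : program) (c k : nat), forall x : X,
  exists2 t, runs P (enc x) (enc (f x)) t & t <= c * dsize (enc x) ^ k + c.
Proof.
(* The entry expression becomes function 0, so its auxiliary functions are linked from position
   1. *)
case=> T [k hk] /(_ 1) [Q [e he]]; exists (e :: Q), (3 ^ k), k => x.
have [t le_t ev] := he [:: e] [::] erefl x [::].
rewrite cats0 in ev; exists t => //.
apply: leq_trans le_t _; apply: leq_trans (hk x) _.
(* Every tree has at least one node, so its size plus 2 is at most 3 times its size; this gives the
   factor [3 ^ k]. *)
apply: leq_trans (leq_addr _ _); rewrite -expnMn /csize.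
case: (k) => // k'; rewrite leq_exp2r //.
by case: (enc x) => //= a b; lia.
Qed.


Theorem theorem4p2 :
  exists (P : program) (c k : nat),
  forall (alpha : rat) (halpha : (0 <= alpha <= 1)%R) (I : instance),
  exists (s : shift_action I) (time : nat),
    [/\ runs P (enc_input alpha I) (enc_action s) time,
        time <= c * dsize (enc_input alpha I) ^ k + c,
        successful (copeland alpha) s
      & exists2 o : nat, is_opt (copeland alpha) I o &
          cost s <= ncand I * o].
Proof.
have [P [c [k hP]]] := PT_program (PT_solve (PT_id input)).
exists P, c, k => alpha halpha I; set x := instance_input alpha I.
have [o opt] := opt_exists I halpha.
have [[t st cost_t] _] := opt.
have [D Dx [wD le_D]] := wins_budget halpha st.
have [w_best le_best] := best_spec Dx wD.
have [time run le_time] := hP x.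
exists (action alpha I (best x)), time; rewrite -enc_instance_input; split=> //.
- suff -> : enc_action (action alpha I (best x)) = enc (solve x) by [].
  rewrite /solve votersE -map_comp; congr enc_seq.
- by rewrite -winsE.
exists o => //; apply: leq_trans (cost_action _ _ _) _.
by rewrite leq_mul2l -cost_t (leq_trans le_best) ?orbT.
Qed.
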